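(* Let $\Gamma$ be a finitely generated elementary amenable group. If $\Gamma$ has polynomial containment, then $\Gamma$ is virtually nilpotent, and hence $\Gamma$ has polynomial growth.
   Context: The class of elementary amenable groups is the smallest class of groups containing all finite groups and all abelian groups, and closed under taking subgroups, quotients, extensions, and direct unions (i.e. directed unions). Let $G$ be a connected, locally finite graph, with combinatorial metric $\mathrm{dist}_G$ on its vertices ($\mathrm{dist}_G(x,y)$ is the length of a shortest edge-path from $x$ to $y$), and let $d$ be a non-negative integer. The graph $G$ has polynomial containment of degree at most $d$ if there is a constant $C>0$ such that for every finite set $X_0$ of vertices of $G$ there is a sequence $\{W_k : k\ge 1\}$ of subsets of vertices of $G$ such that: (1) for every $n\ge 1$, $|W_n|\le Cn^d$; (2) $X_n\cap W_{n+1}=\emptyset$ for every $n\ge 0$, where for $n\geq 1$ the set $X_n$ is defined recursively as the set of vertices at distance at most one from $X_{n-1}$ that do not belong to $W_1\cup\cdots\cup W_n$; (3) there is an integer $T>0$ such that $X_n=X_T$ for every $n\ge T$. A finitely generated group has polynomial containment of degree at most $d$ if its Cayley graph with respect to a finite generating set has polynomial containment of degree at most $d$ (this does not depend on the choice of finite generating set, since the property is preserved by quasi-isometry among connected graphs of bounded degree). A finitely generated group has polynomial containment if it has polynomial containment of degree at most $d$ for some non-negative integer $d$. For a connected, locally finite graph $G$ with a chosen vertex $g_0$, let $\beta(n)$ be the number of vertices at distance at most $n$ from $g_0$. The graph $G$ has polynomial growth of degree at most $d$ if there is a constant $C>0$ such that $\beta(n)\le Cn^d$ for every integer $n\ge 1$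 (this is independent of $g_0$). A finitely generated group has polynomial growth if its Cayley graph with respect to a finite generating set has polynomial growth of degree at most $d$ for some non-negative integer $d$ (this is independent of the finite generating set). *)

(* Defs.v *)
From HB Require Import structures.
From mathcomp Require Import all_boot.
From mathcomp Require Import boolp classical_sets functions cardinality.

Set Implicit Arguments.
Unset Strict Implicit.
Unset Printing Implicit Defensive.

Local Open Scope group_scope.
Local Open Scope classical_set_scope.
Local Open Scope card_scope.

(* A simple graph; loops and multiple edges are irrelevant to [dist]. *)
Record graph := Graph {
  vertex :> choiceType;
  adj : rel vertex;
  adj_sym : symmetric adj;
  adj_irr : irreflexive adj;
  adj_locally_finite : forall x, finite_set [set y | adj x y];
  adj_connected : forall x y, exists p, path adj x p /\ last x p = y }.

Definition edge_path (G : graph) (x y : G) (n : nat) : Prop :=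
  exists p, [/\ path (@adj G) x p, last x p = y & size p = n].

Lemma edge_path_ex (G : graph) (x y : G) : exists n, `[< edge_path x y n >].
Proof.
have [p [xp py]] := adj_connected x y.
by exists (size p); apply/asboolP; exists p.
Qed.

Definition dist (G : graph) (x y : G) : nat := ex_minn (edge_path_ex x y).

Fixpoint containment_seq (G : graph) (W : nat -> set G) (X0 : set G) (n : nat)
    : set G :=
  if n is m.+1 then
    [set v | (exists2 u, containment_seq W X0 m u & (dist v u <= 1)%N) /\
             (forall i, (1 <= i <= m.+1)%N -> ~ W i v)]
  else X0.

(* [W 0] is never used. Taking the constant [C] in [nat] is harmless: a real
   constant can be rounded up. *)
Definition graph_containment (G : graph) (d : nat) : Prop :=
  exists2 C : nat, (0 < C)%N &
  forall X0 : set G, finite_set X0 ->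
  exists W : nat -> set G,
    let X := containment_seq W X0 in
    [/\ forall n, (1 <= n)%N -> W n #<= `I_((C * n ^ d)%N),
        forall n, X n `&` W n.+1 = set0
      & exists2 T, (0 < T)%N & forall n, (T <= n)%N -> X n = X T].

Definition graph_growth (G : graph) (g0 : G) (d : nat) : Prop :=
  exists2 C : nat, (0 < C)%N &
  forall n, (1 <= n)%N -> [set v | (dist g0 v <= n)%N] #<= `I_((C * n ^ d)%N).

Definition subgroup (G : groupType) (H : set G) : Prop := group_closed [in H].

Definition generated (G : groupType) (A : set G) : set G :=
  smallest (@subgroup G) A.

Definition generates (G : groupType) (S : seq G) : Prop :=
  generated [set` S] = [set: G].

Definition finitely_generated (G : groupType) : Prop :=
  exists S : seq G, generates S.

Definition cayley_adj (G : groupType) (S : seq G) : rel G :=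
  [rel x y | (x != y) && ((x^-1 * y \in S) || (y^-1 * x \in S))].

Section Cayley.
Variables (G : groupType) (S : seq G).

Lemma cayley_sym : symmetric (cayley_adj S).
Proof. by move=> x y; rewrite /cayley_adj /= eq_sym orbC. Qed.

Lemma cayley_irr : irreflexive (cayley_adj S).
Proof. by move=> x; rewrite /cayley_adj /= eqxx. Qed.

Lemma cayley_locally_finite x : finite_set [set y | cayley_adj S x y].
Proof.
apply: (@sub_finite_set _ _
  [set` [seq x * s | s <- S] ++ [seq x * s^-1 | s <- S]]); last first.
  exact: finite_seq.
move=> y /= /andP[_ /orP[Sxy|Syx]]; rewrite mem_cat; apply/orP; [left|right].
  by apply/mapP; exists (x^-1 * y); rewrite // mulVKg.
by apply/mapP; exists (y^-1 * x); rewrite // invgM invgK mulVKg.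
Qed.

Hypothesis genS : generates S.

Lemma cayley_connected x y :
  exists p, path (cayley_adj S) x p /\ last x p = y.
Proof.
pose H : set G := [set g | forall z, exists p,
  path (cayley_adj S) z p /\ last z p = z * g].
have HS (s : G) : s \in S -> H s.
  move=> Ss z; have [zs|zs] := eqVneq z (z * s); first by exists [::].
  by exists [:: z * s]; rewrite /cayley_adj /= zs mulKg Ss.
have H1 : H 1 by move=> z; exists [::]; rewrite /= mulg1.
have HM g h : H g -> H h -> H (g * h).
  move=> Hg Hh z; have [p [zp pE]] := Hg z; have [q [zq qE]] := Hh (z * g).
  by exists (p ++ q); rewrite cat_path last_cat zp pE zq qE mulgA.
have HV g : H g -> H g^-1.
  move=> Hg z; have [p [zp pE]] := Hg (z * g^-1).
  rewrite mulgVK in pE; exists (rev (belast (z * g^-1) p)); split.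
    by rewrite -[X in path _ X]pE rev_path (eq_path (e' := cayley_adj S)) // => a b;
       rewrite cayley_sym.
  case: p pE {zp} => [|a p] pE; first by rewrite /= in pE *.
  by rewrite /= rev_cons last_rcons.
have sH : subgroup H.
  split; first exact: mem_set.
  move=> g h /set_mem Hg /set_mem Hh; apply: mem_set.
  exact: HM Hg (HV _ Hh).
have : generated [set` S] (x^-1 * y) by rewrite genS.
move=> /(_ H (conj sH HS)) /(_ x) [p [xp pE]].
by exists p; rewrite pE mulVKg.
Qed.

Definition cayley_graph : graph :=
  Graph cayley_sym cayley_irr cayley_locally_finite cayley_connected.

End Cayley.

Definition polynomial_containment_degree (G : groupType) (d : nat) : Prop :=
  exists (S : seq G) (genS : generates S), graph_containment (cayley_graph genS) d.

Definition polynomial_containment (G : groupType) : Prop :=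
  exists d, polynomial_containment_degree G d.

Definition polynomial_growth (G : groupType) : Prop :=
  exists (S : seq G) (genS : generates S) (d : nat),
    @graph_growth (cayley_graph genS) (1 : G) d.

(* Class membership is isomorphism invariant, so subgroups, quotients,
   extensions and directed unions are given by morphisms. *)
Inductive elementary_amenable : groupType -> Prop :=
| EA_finite (G : groupType) :
    finite_set [set: G] -> elementary_amenable G
| EA_abelian (G : groupType) :
    (forall x y : G, commute x y) -> elementary_amenable G
| EA_subgroup (G H : groupType) (f : H -> G) :
    monoid_morphism f -> injective f ->
    elementary_amenable G -> elementary_amenable H
| EA_quotient (G Q : groupType) (f : G -> Q) :
    monoid_morphism f -> range f = [set: Q] ->
    elementary_amenable G -> elementary_amenable Q
| EA_extension (N G Q : groupType) (f : N -> G) (g : G -> Q) :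
    monoid_morphism f -> monoid_morphism g ->
    injective f -> range f = g @^-1` [set 1] -> range g = [set: Q] ->
    elementary_amenable N -> elementary_amenable Q -> elementary_amenable G
| EA_union (G : groupType) (I : Type) (H : I -> groupType)
    (f : forall i, H i -> G) :
    (forall i, monoid_morphism (f i)) -> (forall i, injective (f i)) ->
    (forall i j, exists k, range (f i) `|` range (f j) `<=` range (f k)) ->
    \bigcup_i range (f i) = [set: G] ->
    (forall i, elementary_amenable (H i)) -> elementary_amenable G.

Fixpoint lower_central (G : groupType) (H : set G) (n : nat) : set G :=
  if n is m.+1 then
    generated [set [~ x, y] | x in lower_central H m & y in H]
  else H.

Definition nilpotent (G : groupType) (H : set G) : Prop :=
  exists n, lower_central H n = [set 1].

Definition finite_index (G : groupType) (H : set G) : Prop :=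
  finite_set (range (fun x : G => [set x * h | h in H])).

Definition virtually_nilpotent (G : groupType) : Prop :=
  exists H : set G, [/\ subgroup H, finite_index H & nilpotent H].

(* Main.v *)
Require Import Defs.
From HB Require Import structures.
From mathcomp Require Import all_boot all_order all_algebra all_field.
From mathcomp Require Import finmap boolp classical_sets cardinality.
From mathcomp Require Import zify.

(** Containment is used through one consequence.  If a and b generated a free
    semigroup, the Cayley graph would contain a binary tree whose edges are
    walks of bounded length.  A vertex protected at time n blocks boundedly many
    of these walks on each level, so polynomially many protected vertices only
    cause a polynomial loss against the doubling of the fire at each level, and
    a fire that starts on a high enough level is never contained
    ([containment_no_free_semigroup]).  Hence, for all t and x, two distinct
    words of equal length in t and t x coincide, which is a relation between the
    conjugates of x by powers of t with exponents 0 and 1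
    ([conjword_relation]).

    From then on the ambient group Gamma is fixed, and its finitely generated
    subgroups are shown to be good: virtually nilpotent and of polynomial
    growth.  The relations say that if M <t> is finitely generated and t
    normalizes M, then M is finitely generated ([fg_of_adjoin]); so one can
    descend along a series with cyclic or finite factors, and climb up again.
    Climbing is [good_adjoin].  Some power of t normalizes a nilpotent
    subgroup M0 of finite index in M.  On each factor of the lower central
    series of M0, a finitely generated abelian group, conjugation by t is an
    automorphism tau such that every vector is killed, for every k, by a nonzero
    polynomial in tau ^ k with coefficients in {-1, 0, 1}.  An eigenvalue x of
    tau and all its conjugates then satisfy |x ^ k| < 2 for every k, so x is a
    root of unity by Kronecker's theorem, and a power s of t acts unipotently on
    all the factors ([quasi_unipotent], [descending_lower_central]).  Then
    M0 <s> is nilpotent and of finite index in M <t>; and as s distorts word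
    lengths in M0 only polynomially, polynomial growth passes from M0 to M0 <s>
    ([pgrowth_adjoin]).

    The elementary amenable hypothesis is used by induction on the class, for a
    statement about sections: if L is a finitely generated subgroup of Gamma
    with a normal subgroup N such that L / N is a section of G, and if N is good
    once it is finitely generated, then L is good ([tame]).  Finite and abelian
    G are dealt with by descending and climbing as above, and the closure
    operations are formal ([elementary_amenable_tame]).  The theorem is the case
    L = G = Gamma and N = 1. *)

Set Implicit Arguments.
Unset Strict Implicit.
Unset Printing Implicit Defensive.

Import Order.TTheory GRing.Theory Num.Theory.
Local Open Scope classical_set_scope.

(** * Subgroups, balls and subgroups of finite index *)

Section Subgroups.
Local Open Scope group_scope.
Variable G : groupType.
Implicit Types (A B H K L M N : set G) (x y z : G) (S : seq G).

Lemma subgroupP H :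
  subgroup H <-> [/\ H 1, forall x y, H x -> H y -> H (x * y)
                   & forall x, H x -> H x^-1].
Proof.
split=> [[H1 HD]|[H1 HM HV]].
  have {}H1 : H 1 by apply: set_mem.
  have {}HD x y : H x -> H y -> H (x / y).
    by move=> Hx Hy; apply: set_mem; apply: HD; apply: mem_set.
  have HV x : H x -> H x^-1 by move=> Hx; rewrite -div1g; apply: HD.
  by split=> // x y Hx Hy; rewrite -[y]invgK; apply: HD => //; apply: HV.
split; first exact: mem_set.
by move=> x y /set_mem Hx /set_mem Hy; apply: mem_set; apply: HM => //; apply: HV.
Qed.

Lemma subgroup1 H : subgroup H -> H 1. Proof. by case/subgroupP. Qed.

Lemma subgroupM H x y : subgroup H -> H x -> H y -> H (x * y).
Proof. by case/subgroupP=> _ HM _; apply: HM. Qed.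

Lemma subgroupV H x : subgroup H -> H x -> H x^-1.
Proof. by case/subgroupP=> _ _; apply. Qed.

Lemma subgroupX H x n : subgroup H -> H x -> H (x ^+ n).
Proof.
move=> sH Hx; elim: n => [|n IH]; first exact: subgroup1.
by rewrite expgS; apply: subgroupM.
Qed.

Lemma subgroupMl H x y : subgroup H -> H x -> H (x * y) -> H y.
Proof.
by move=> sH Hx Hxy; rewrite -(mulKg x y); apply: subgroupM => //; apply: subgroupV.
Qed.

Lemma subgroupMr H x y : subgroup H -> H y -> H (x * y) -> H x.
Proof.
by move=> sH Hy Hxy; rewrite -(mulgK y x); apply: subgroupM => //; apply: subgroupV.
Qed.

Lemma subgroupJ H x y : subgroup H -> H x -> H y -> H (x ^ y).
Proof.
move=> sH Hx Hy; rewrite conjgE.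
by apply: subgroupM; [|apply: subgroupV|apply: subgroupM].
Qed.

Lemma subgroup_trivial : subgroup [set 1 : G].
Proof. by apply/subgroupP; split=> // [x y -> ->|x ->]; rewrite ?mulg1 ?invg1. Qed.

Lemma subgroup_gen A : subgroup (generated A).
Proof.
apply/subgroupP; split=> [K [sK _]|x y Hx Hy K sK|x Hx K sK].
- exact: subgroup1.
- by apply: subgroupM; [case: sK|apply: Hx|apply: Hy].
- by apply: subgroupV; [case: sK|apply: Hx].
Qed.

Lemma sub_gen A : A `<=` generated A.
Proof. exact: sub_gen_smallest. Qed.

Lemma gen_sub A H : subgroup H -> A `<=` H -> generated A `<=` H.
Proof. exact: smallest_sub. Qed.

Lemma genS A B : A `<=` B -> generated A `<=` generated B.
Proof.
by move=> AB; apply: gen_sub; [apply: subgroup_gen|apply: subset_trans AB (@sub_gen _)].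
Qed.

Lemma gen_id H : subgroup H -> generated H = H.
Proof. by move=> sH; apply: smallest_id. Qed.

Definition fg H := exists S, H = generated [set` S].

Lemma fg_subgroup H : fg H -> subgroup H.
Proof. by case=> S ->; apply: subgroup_gen. Qed.

(** A letter is allowed to be the identity, so that [ball A n] is the set of
    values of the words of length at most n. *)
Fixpoint ball A n : set G :=
  if n is m.+1 then
    [set x * y | x in ball A m & y in [set y | [\/ y = 1, A y | A y^-1]]]
  else [set 1].

Lemma ball1 A n : ball A n 1.
Proof.
elim: n => //= n IH; exists 1 => //; exists 1; last by rewrite mulg1.
by constructor.
Qed.

Lemma ball_mul A m n x y : ball A m x -> ball A n y -> ball A (m + n) (x * y).
Proof.
move=> mx; elim: n y => [y ->|n IH _ [y ny [s sA <-]]]; first by rewrite addn0 mulg1.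
by rewrite addnS mulgA; exists (x * y); [apply: IH|exists s].
Qed.

Lemma ball_le A m n : (m <= n)%N -> ball A m `<=` ball A n.
Proof.
by move=> mn x mx; rewrite -(subnKC mn) -[x]mulg1; apply: ball_mul => //; apply: ball1.
Qed.

Lemma ball_letter A x : [\/ x = 1, A x | A x^-1] -> ball A 1 x.
Proof. by move=> Ax; exists 1 => //; exists x; rewrite ?mul1g. Qed.

Lemma ball_inv A n x : ball A n x -> ball A n x^-1.
Proof.
elim: n x => [_ ->|n IH _ [x nx [s sA <-]]]; first by rewrite /= invg1.
rewrite invgM -add1n; apply: ball_mul; last exact: IH.
apply: ball_letter; case: sA => [->|sA|sA]; first by rewrite invg1; constructor 1.
  by constructor 3; rewrite invgK.
by constructor 2.
Qed.

Lemma ball_sub A H n : subgroup H -> A `<=` H -> ball A n `<=` H.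
Proof.
move=> sH AH; elim: n => [_ ->|n IH _ [x nx [s sA <-]]]; first exact: subgroup1.
apply: subgroupM => //; first exact: IH.
case: sA => [->|/AH//|/AH Hs]; first exact: subgroup1.
by rewrite -[s]invgK; apply: subgroupV.
Qed.

Lemma gen_ball A x : generated A x -> exists n, ball A n x.
Proof.
move: x; apply: gen_sub; last first.
  by move=> x Ax; exists 1%N; apply: ball_letter; constructor 2.
apply/subgroupP; split=> [|x y [m mx] [n ny]|x [n nx]]; first by exists 0%N.
- by exists (m + n)%N; apply: ball_mul.
- by exists n; apply: ball_inv.
Qed.

Lemma ball_ball A S c n :
  [set` S] `<=` ball A c -> ball [set` S] n `<=` ball A (c * n).
Proof.
move=> SA; elim: n => [_ ->|n IH _ [x nx [s sA <-]]]; first exact: ball1.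
rewrite mulnS addnC; apply: ball_mul; first exact: IH.
case: sA => [->|/SA//|/SA]; first exact: ball1.
by move/ball_inv; rewrite invgK.
Qed.

Lemma ball_seq A S : [set` S] `<=` generated A -> exists c, [set` S] `<=` ball A c.
Proof.
elim: S => [|s S IH] SA; first by exists 0%N.
have [|c cS] := IH; first by move=> x xS; apply: SA; rewrite /= inE xS orbT.
have [|b bs] := @gen_ball A s; first by apply: SA; rewrite /= mem_head.
exists (b + c)%N => x; rewrite /= inE => /orP[/eqP ->|xS].
  by apply: ball_le bs; apply: leq_addr.
by apply: ball_le (cS _ xS); apply: leq_addl.
Qed.

Definition poly_balls A := exists C d, forall n,
  exists2 l : seq G, (size l <= C * n.+1 ^ d)%N & ball A n `<=` [set` l].

(** Quantifying over all finite subsets makes the notion inherited by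
    arbitrary subgroups and independent of generating sets. *)
Definition pgrowth H := forall S, [set` S] `<=` H -> poly_balls [set` S].

Lemma pgrowthS H K : H `<=` K -> pgrowth K -> pgrowth H.
Proof. by move=> HK gK S SH; apply: gK; apply: subset_trans HK. Qed.

Lemma poly_balls_gen A H : H `<=` generated A -> poly_balls A -> pgrowth H.
Proof.
move=> HA [C [d gA]] S SH.
have [c cS] := ball_seq (subset_trans SH HA).
exists (C * c.+1 ^ d)%N, d => n.
have [l sl bl] := gA (c * n)%N; exists l; last first.
  exact: subset_trans (ball_ball cS) bl.
apply: leq_trans sl _; rewrite -mulnA -expnMn leq_mul2l; apply/orP; right.
by case: (d) => // e; rewrite leq_exp2r //; nia.
Qed.

Definition finindex H K := exists R : seq G,
  forall x, K x -> exists2 r, r \in R & H (r^-1 * x).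

Lemma finindex_trans H K L : finindex H K -> finindex K L -> finindex H L.
Proof.
move=> [R RK] [T TL]; exists [seq t * r | t <- T, r <- R] => x /TL[t tT /RK[r rR Hx]].
by exists (t * r); [apply: allpairs_f|rewrite invgM -mulgA].
Qed.

(** Pushing the letters of a word past coset representatives, one at a time,
    rewrites it over the finite set T of elements r'^-1 s r of H. *)
Lemma ball_cosets H K S : subgroup H -> H `<=` K -> finindex H K ->
  subgroup K -> [set` S] `<=` K ->
  exists2 T : seq G, [set` T] `<=` H & exists2 R : seq G,
    [set` R] `<=` K & forall n x, ball [set` S] n x ->
    exists r h, [/\ r \in R, ball [set` T] n h & x = r * h].
Proof.
move=> sH HK [R0 R0K] sK SK.
pose R := 1 :: [seq r <- R0 | `[< K r >]].
have RK : [set` R] `<=` K.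
  move=> x; rewrite /= inE mem_filter => /orP[/eqP->|/andP[/asboolP//]].
  exact: subgroup1.
have RP x : K x -> exists2 r, r \in R & H (r^-1 * x).
  move=> Kx; have [r rR Hr] := R0K x Kx; exists r => //.
  rewrite inE mem_filter rR andbT orbC; apply/orP; left; apply/asboolP.
  rewrite -[r]invgK; apply: subgroupV => //.
  by apply: subgroupMr Kx (HK _ Hr).
pose S' := 1 :: S ++ [seq s^-1 | s <- S].
have S'K : [set` S'] `<=` K.
  move=> x; rewrite /= inE mem_cat => /or3P[/eqP->|xS|/mapP[s sS ->]].
  - exact: subgroup1.
  - exact: SK.
  - by apply: subgroupV => //; apply: SK.
have S'P s : [\/ s = 1, s \in S | s^-1 \in S] -> s \in S'.
  rewrite inE mem_cat; case=> [->|->|sS]; rewrite ?eqxx ?orbT //.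
  by apply/or3P/Or33/mapP; exists s^-1; rewrite ?invgK.
pose T := [seq x <- [seq r'^-1 * y | r' <- R, y <- [seq s * r | s <- S', r <- R]]
             | `[< H x >]].
have TH : [set` T] `<=` H by move=> x; rewrite /= mem_filter => /andP[/asboolP].
exists T => //; exists R => // n x nx.
(* Letters are appended on the right, but representatives absorb letters on
   their left. *)
suff H' y : ball [set` S] n y ->
    exists r h, [/\ r \in R, ball [set` T] n h & y^-1 = r * h].
  by rewrite -[x]invgK; apply/H'/ball_inv.
elim: n y {x nx} => [_ ->|n IH _ [x nx [s sA <-]]].
  by exists 1, 1; rewrite mem_head invg1 mulg1.
have [r [h [rR hT xE]]] := IH x nx.
have sS' : s^-1 \in S'.
  apply: S'P; case: sA => [->|sS|sS]; first by rewrite invg1; constructor 1.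
    by constructor 3; rewrite invgK.
  by constructor 2.
have [|r' r'R Hr'] := RP (s^-1 * r).
  by apply: subgroupM => //; [apply: S'K|apply: RK].
exists r', (r'^-1 * (s^-1 * r) * h); split => //; last first.
  by rewrite invgM xE !mulgA mulgV mul1g.
rewrite -add1n; apply: ball_mul => //; apply: ball_letter; constructor 2.
rewrite /= mem_filter; apply/andP; split; first exact/asboolP.
apply: (@allpairs_f _ _ _ (fun r y : G => r^-1 * y)) => //.
by apply: (@allpairs_f _ _ _ (fun x y : G => x * y)).
Qed.

(** Schreier's lemma: the elements T of [ball_cosets] generate H, together with
    the representatives that happen to lie in H. *)
Lemma fg_finindex H K : subgroup H -> H `<=` K -> finindex H K -> fg K -> fg H.
Proof.
move=> sH HK fHK fK; have sK := fg_subgroup fK; case: fK => S KE.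
have [|T TH [R RK P]] := @ball_cosets H K S sH HK fHK sK.
  by rewrite KE; apply: sub_gen.
pose U := T ++ [seq r <- R | `[< H r >]].
exists U; apply/seteqP; split; last first.
  apply: gen_sub => // x; rewrite /= mem_cat mem_filter.
  by case/orP => [/TH//|/andP[/asboolP]].
move=> x Hx; have [n /P[r [h [rR hT xE]]]] : exists n, ball [set` S] n x.
  by apply: gen_ball; rewrite -KE; apply: HK.
have Hh : H h by apply: ball_sub hT.
rewrite xE; apply: subgroupM (subgroup_gen _) _ _.
  apply: sub_gen; rewrite /= mem_cat mem_filter rR andbT; apply/orP; right.
  by apply/asboolP; apply: subgroupMr Hh _ => //; rewrite -xE.
apply: ball_sub hT; first exact: subgroup_gen.
by move=> y yT; apply: sub_gen; rewrite /= mem_cat yT.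
Qed.

Lemma pgrowth_finindex H K :
  subgroup H -> H `<=` K -> finindex H K -> subgroup K -> pgrowth H -> pgrowth K.
Proof.
move=> sH HK fHK sK gH S SK.
have [T TH [R RK P]] := ball_cosets sH HK fHK sK SK.
have [C [d gT]] := gH T TH.
exists (size R * C)%N, d => n; have [l sl bl] := gT n.
exists [seq r * h | r <- R, h <- l].
  by rewrite size_allpairs -mulnA leq_mul2l sl orbT.
by move=> x /P[r [h [rR /bl hl ->]]]; apply: allpairs_f.
Qed.

Definition vnil K := exists H, [/\ subgroup H, H `<=` K, finindex H K & nilpotent H].

(** Both properties are propagated together: the growth of M <t> is obtained
    from the series that also shows its virtual nilpotency. *)
Definition good K := vnil K /\ pgrowth K.

Lemma good_finindex H K :
  subgroup H -> H `<=` K -> finindex H K -> subgroup K -> good H -> good K.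
Proof.
move=> sH HK fHK sK [[M [sM MH fMH nM]] gH]; split; last exact: pgrowth_finindex gH.
exists M; split => //; first exact: subset_trans HK.
exact: finindex_trans fHK.
Qed.

End Subgroups.

(** * Relations between conjugates and cyclic extensions *)

Section CyclicExtensions.
Local Open Scope group_scope.
Variable G : groupType.
Implicit Types (A B F H K L M N : set G) (t x y z : G) (S : seq G).

Definition wordval (a b : G) (u : seq bool) : G :=
  foldr (fun c g => (if c then b else a) * g) 1 u.

(** Words of the same length are compared so that, evaluated at t and t x, they
    give a relation between conjugates of x alone. *)
Definition no_free_semigroup := forall a b : G, exists u v : seq bool,
  [/\ size u = size v, u <> v & wordval a b u = wordval a b v].

(** Moving all letters t of a word in t and t x to the front leaves a product of
    conjugates of x, with strictly decreasing powers of t. *)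
Fixpoint conjword x t (u : seq bool) : G :=
  if u is c :: v then (x ^ (t ^+ size v)) ^+ c * conjword x t v else 1.

Lemma wordval_conj x t u : wordval t (t * x) u = t ^+ size u * conjword x t u.
Proof.
elim: u => [|c u IH] /=; first by rewrite mulg1.
rewrite IH expgS; case: c; rewrite ?expg0 ?expg1 ?mul1g !mulgA //.
by congr (_ * _); rewrite -!mulgA; congr (_ * _); rewrite -conjgC.
Qed.

Lemma conjword_relation x t : no_free_semigroup -> exists u v : seq bool,
  [/\ size u = size v, u <> v & conjword x t u = conjword x t v].
Proof.
move=> /(_ t (t * x))[u [v [uv nuv]]]; rewrite !wordval_conj uv => /mulgI e.
by exists u, v.
Qed.

Lemma conjword_gen x t u :
  generated [set x ^ (t ^+ i) | i in `I_(size u)] (conjword x t u).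
Proof.
elim: u => [|c u IH] /=; first exact: subgroup1 (subgroup_gen _).
apply: subgroupM (subgroup_gen _) _ _; last first.
  by apply: genS IH => _ [i /= iu <-]; exists i => //=; apply: ltnW.
apply: subgroupX (subgroup_gen _) _; apply: sub_gen.
by exists (size u) => //=.
Qed.

(** The first letter where two words differ carries the highest power of t,
    and can be solved for. *)
Lemma conj_in_gen x t : no_free_semigroup ->
  exists n, generated [set x ^ (t ^+ i) | i in `I_n] (x ^ (t ^+ n)).
Proof.
move=> /(conjword_relation x t)[u [v []]].
elim: u v => [|c u IH] [|d v] //= [suv] ne.
have [dc|cd] := eqVneq c d.
  rewrite -dc suv => /mulgI e.
  by apply: (IH v) => // uv; apply: ne; rewrite uv dc.
wlog: c d u v {IH} suv ne cd / c = true => [W|].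
  case: c ne cd => ne cd; first exact: (W true d u v).
  by case: d ne cd => // ne _ /esym; apply: (W true false v u) => //; exact: nesym.
move=> c1; move: cd; rewrite {}c1 {ne}; case: d => // _; rewrite expg0 expg1 mul1g => e.
exists (size u); set A := (X in generated X).
have Au : generated A (conjword x t u) by apply: conjword_gen.
have Av : generated A (conjword x t v) by rewrite /A suv; apply: conjword_gen.
by rewrite -e in Av; apply: subgroupMr Av => //; apply: subgroup_gen.
Qed.

Lemma conj_gen A x t : generated A x -> generated [set a ^ t | a in A] (x ^ t).
Proof.
move: x; apply: gen_sub; last by move=> x Ax; apply: sub_gen; exists x.
have sg := subgroup_gen [set a ^ t | a in A].
apply/subgroupP; split=> [|x y /= Hx Hy|x /= Hx].
- by rewrite /= conj1g; apply: subgroup1.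
- by rewrite conjMg; apply: (subgroupM sg).
- by rewrite conjVg; apply: (subgroupV sg).
Qed.

Definition normalizes M t := forall x, M (x ^ t) <-> M x.

Lemma normalizesP M t :
  (forall x, M x -> M (x ^ t)) -> (forall x, M x -> M (x ^ t^-1)) -> normalizes M t.
Proof. by move=> H1 H2 x; split=> [/H2|/H1//]; rewrite conjgK. Qed.

Lemma normalizesV M t : normalizes M t -> normalizes M t^-1.
Proof. by move=> nM x; rewrite -nM conjgKV. Qed.

Lemma normalizesM M t u : normalizes M t -> normalizes M u -> normalizes M (t * u).
Proof. by move=> nt nu x; rewrite conjgM nu nt. Qed.

Lemma normalizesX M t n : normalizes M t -> normalizes M (t ^+ n).
Proof.
by move=> nM; elim: n => [|n IH] x; rewrite ?expg0 ?conjg1 // expgS; apply: normalizesM.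
Qed.

Lemma normalizes_sub M t : subgroup M -> M t -> normalizes M t.
Proof.
by move=> sM Mt; apply: normalizesP => x Mx; apply: subgroupJ => //; apply: subgroupV.
Qed.

Lemma normalizes_gen A t : (forall x, A x -> generated A (x ^ t)) ->
  (forall x, A x -> generated A (x ^ t^-1)) -> normalizes (generated A) t.
Proof.
have sg := subgroup_gen A.
have key u : (forall x, A x -> generated A (x ^ u)) ->
    forall x, generated A x -> generated A (x ^ u).
  move=> Au x /(conj_gen (t := u)); apply: gen_sub => //.
  by move=> _ [y Ay <-]; apply: Au.
by move=> *; apply: normalizesP; apply: key.
Qed.

(** Once x ^ (t ^+ n) is expressed by conjugates with smaller exponents, so are
    all later conjugates; the negative exponents are those of t^-1. *)
Lemma orbit_fg x t : no_free_semigroup -> exists T : seq G,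
  [/\ forall M, normalizes M t -> M x -> [set` T] `<=` M,
      generated [set` T] x & normalizes (generated [set` T]) t].
Proof.
move=> nf; have [n xn] := conj_in_gen x t nf; have [m xm] := conj_in_gen x t^-1 nf.
pose T := x :: [seq x ^ (t ^+ i) | i <- iota 0 n] ++ [seq x ^ (t^-1 ^+ i) | i <- iota 0 m].
exists T; have sT := subgroup_gen [set` T].
have key u k : generated [set x ^ (u ^+ i) | i in `I_k] (x ^ (u ^+ k)) ->
    (forall i, (i < k)%N -> x ^ (u ^+ i) \in T) ->
    forall i, generated [set` T] (x ^ (u ^+ i)).
  move=> xk kT i; have [j] := ubnP i; elim: j i => // j IH i.
  rewrite ltnS => ij; have [ik|ki] := ltnP i k; first by apply: sub_gen; apply: kT.
  rewrite -(subnKC ki) expgnDr conjgM.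
  move: (conj_gen (t := u ^+ (i - k)) xk); apply: gen_sub => //.
  move=> _ [_ [l /= lk <-] <-]; rewrite -conjgM -expgnDr; apply: IH; lia.
have {xn} Tn := key t n xn; have {xm} Tm := key t^-1 m xm.
have {}Tn i : generated [set` T] (x ^ (t ^+ i)).
  apply: Tn => j jn; rewrite inE mem_cat; apply/or3P/Or32/mapP.
  by exists j; rewrite ?mem_iota.
have {}Tm i : generated [set` T] (x ^ (t^-1 ^+ i)).
  apply: Tm => j jn; rewrite inE mem_cat; apply/or3P/Or33/mapP.
  by exists j; rewrite ?mem_iota.
split.
- move=> M nM Mx y; rewrite /= inE mem_cat => /or3P[/eqP->//|/mapP[i _ ->]|/mapP[i _ ->]].
    exact/normalizesX.
  by apply/normalizesX => //; apply: normalizesV.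
- by apply: sub_gen; rewrite /= mem_head.
have TP y : y \in T -> exists i, y = x ^ (t ^+ i) \/ y = x ^ (t^-1 ^+ i).
  rewrite inE mem_cat => /or3P[/eqP->|/mapP[i _ ->]|/mapP[i _ ->]].
  - by exists 0%N; left; rewrite conjg1.
  - by exists i; left.
  - by exists i; right.
apply: normalizes_gen => y /TP[i [->|->]]; rewrite -conjgM.
- by rewrite -expgSr.
- case: i => [|i]; first by rewrite expg0 mul1g -[t]expg1.
  by rewrite expgSr mulgVK.
- case: i => [|i]; first by rewrite expg0 mul1g -[t^-1]expg1.
  by rewrite expgSr mulgK.
- by rewrite -expgSr.
Qed.

(** This is the subgroup M <t> when t normalizes M.  Writing an integer power of
    t as a quotient of two natural powers avoids a case split on its sign. *)
Definition adjoin M t : set G :=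
  [set x | exists a b y, M y /\ x = t ^- a * t ^+ b * y].

Lemma commuteXV t a b : t ^+ b * t ^- a = t ^- a * t ^+ b.
Proof. exact/commute_sym/commute_sym/commuteV/commuteX2. Qed.

Lemma sub_adjoin M t : M `<=` adjoin M t.
Proof. by move=> x Mx; exists 0%N, 0%N, x; rewrite invg1 !mul1g. Qed.

Lemma adjoin_powers M t a b : subgroup M -> adjoin M t (t ^- a * t ^+ b).
Proof. by move=> sM; exists a, b, 1; rewrite mulg1; split=> //; apply: subgroup1. Qed.

Lemma adjoin_base M t : subgroup M -> adjoin M t t.
Proof.
move=> sM; rewrite -[X in adjoin _ _ X](mul1g t) -invg1.
exact: (adjoin_powers t 0 1).
Qed.

Lemma normalizes_adjoin F M t x : normalizes F t ->
  (forall y, M y -> normalizes F y) -> adjoin M t x -> normalizes F x.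
Proof.
move=> nt nM [a [b [y [My ->]]]]; apply: normalizesM; last exact: nM.
by apply: normalizesM; [apply: normalizesV|]; apply: normalizesX.
Qed.

Lemma mul_quotients t a b c d :
  (t ^- a * t ^+ b) * (t ^- c * t ^+ d) = t ^- (a + c) * t ^+ (b + d).
Proof.
by rewrite addnC !expgnDr invgM !mulgA -(mulgA _ _ (t ^- c)) commuteXV !mulgA.
Qed.

Lemma inv_quotient t a b : (t ^- a * t ^+ b)^-1 = t ^- b * t ^+ a.
Proof. by rewrite invgM invgK. Qed.

Lemma normalizes_quotient M t a b : normalizes M t -> normalizes M (t ^- a * t ^+ b).
Proof.
by move=> nM; apply: normalizesM; [apply: normalizesV|]; apply: normalizesX.
Qed.

Lemma subgroup_adjoin M t : subgroup M -> normalizes M t -> subgroup (adjoin M t).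
Proof.
move=> sM nM; apply/subgroupP; split; first by apply: sub_adjoin; apply: subgroup1.
  move=> _ _ [a [b [y [My ->]]]] [c [d [z [Mz ->]]]].
  set q := t ^- c * t ^+ d; exists (a + c)%N, (b + d)%N, (y ^ q * z); split.
    by apply: (subgroupM sM) => //; apply/normalizes_quotient.
  by rewrite -mul_quotients -/q; clearbody q; rewrite conjgE !mulgA mulgK.
move=> _ [a [b [y [My ->]]]]; set p := t ^- a * t ^+ b.
exists b, a, (y^-1 ^ p^-1); split; last first.
  by rewrite -inv_quotient -/p; clearbody p; rewrite invgM conjgE invgK !mulgA mulVg mul1g.
by apply/normalizesV; [apply: normalizes_quotient|apply: (subgroupV sM)].
Qed.

Lemma adjoin_sub M t H : subgroup H -> M `<=` H -> H t -> adjoin M t `<=` H.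
Proof.
move=> sH MH Ht _ [a [b [y [My ->]]]].
do 2?[apply: subgroupM => //]; last exact: MH.
  by apply: subgroupV => //; apply: subgroupX.
exact: subgroupX.
Qed.

Lemma adjoinS M M' t : M `<=` M' -> adjoin M t `<=` adjoin M' t.
Proof. by move=> MM' _ [a [b [y [/MM' My ->]]]]; exists a, b, y. Qed.

(** If t ^+ k is the least positive power of t lying in M, it generates the
    powers of t that lie in M. *)
Lemma powers_in_subgroup M t : subgroup M -> exists T : seq G, [set` T] `<=` M /\
  forall a b, M (t ^- a * t ^+ b) -> generated [set` T] (t ^- a * t ^+ b).
Proof.
move=> sM; have [[k Mk]|nk] := pselect (exists k, M (t ^+ k.+1)); last first.
  exists [::]; split=> // a b Mab; have [ab|ba|->] := ltngtP a b.
  - case: nk; exists (b - a).-1; rewrite prednK ?subn_gt0 //.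
    by rewrite expgnFr ?(ltnW ab) // -commuteXV in Mab *.
  - case: nk; exists (a - b).-1; rewrite prednK ?subn_gt0 //.
    move: (subgroupV sM Mab); rewrite inv_quotient expgnFr ?(ltnW ba) //.
    by rewrite commuteXV.
  - by rewrite mulVg; apply: subgroup1 (subgroup_gen _).
have ex : exists k, `[< M (t ^+ k.+1) >] by exists k; apply/asboolP.
case: (ex_minnP ex) => {Mk ex}{}k /asboolP Mk kmin.
exists [:: t ^+ k.+1]; have sT := subgroup_gen [set` [:: t ^+ k.+1]].
have Tk : generated [set` [:: t ^+ k.+1]] (t ^+ k.+1).
  by apply: sub_gen; rewrite /= mem_head.
have key n : M (t ^+ n) -> generated [set` [:: t ^+ k.+1]] (t ^+ n).
  rewrite (divn_eq n k.+1) expgnDr mulnC expgnA => Mn.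
  have Mr : M (t ^+ (n %% k.+1)) by apply: subgroupMl Mn => //; apply: subgroupX.
  apply: (subgroupM sT); first exact: (subgroupX _ sT).
  have := ltn_pmod n (ltn0Sn k); case: (n %% k.+1)%N Mr => [|r] Mr rk.
    exact: (subgroup1 sT).
  by move: (kmin r (asboolT Mr)); lia.
split=> [x|a b]; first by rewrite /= inE => /eqP->.
rewrite -commuteXV; have [ab|ba] := leqP a b.
  by rewrite -expgnFr //; apply: key.
move=> Mab; have Mba : M (t ^+ (a - b)).
  by rewrite expgnFr ?(ltnW ba) // -[_ / _]invgK invgF; apply: (subgroupV sM).
by have := subgroupV sT (key _ Mba); rewrite expgnFr ?(ltnW ba) // invgF.
Qed.

(** Milnor's lemma.  Modulo powers of t, the generators of M <t> lie in M; their
    conjugates by powers of t generate a subgroup M' of M that is finitely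
    generated, with M' <t> = M <t>, and only the powers of t in M are missing. *)
Lemma fg_of_adjoin M t : no_free_semigroup ->
  subgroup M -> normalizes M t -> fg (adjoin M t) -> fg M.
Proof.
move=> nf sM nM [S KE].
have [T [TM tT ST]] : exists T : seq G, [/\ [set` T] `<=` M,
    normalizes (generated [set` T]) t &
    forall s, s \in S -> adjoin (generated [set` T]) t s].
  have: [set` S] `<=` adjoin M t by rewrite KE; apply: sub_gen.
  elim: S {KE} => [_|s S IH SK].
    exists [::]; split=> //; apply: normalizes_gen => x; rewrite /= in_nil.
      by [].
    by [].
  have [|T [TM tT ST]] := IH; first by move=> x xS; apply: SK; rewrite /= inE xS orbT.
  have [|a [b [y [My sE]]]] := SK s; first by rewrite /= mem_head.
  have [U [UM Uy tU]] := orbit_fg y t nf.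
  exists (T ++ U).
  have subT : generated [set` T] `<=` generated [set` T ++ U].
    by apply: genS => z zT; rewrite /= mem_cat zT.
  have subU : generated [set` U] `<=` generated [set` T ++ U].
    by apply: genS => z zU; rewrite /= mem_cat zU orbT.
  split.
  - by move=> z; rewrite /= mem_cat => /orP[/TM//|]; apply: UM.
  - apply: normalizes_gen => x; rewrite /= mem_cat => /orP[xT|xU].
    + by apply: subT; apply: (proj2 (tT _)); apply: sub_gen.
    + by apply: subU; apply: (proj2 (tU _)); apply: sub_gen.
    + by apply: subT; apply: (proj2 (normalizesV tT _)); apply: sub_gen.
    + by apply: subU; apply: (proj2 (normalizesV tU _)); apply: sub_gen.
  - move=> z; rewrite inE => /orP[/eqP->|/ST]; last exact: adjoinS.
    by exists a, b, y; split => //; apply: subU.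
set M' := generated [set` T] in tT ST.
have sM' : subgroup M' := subgroup_gen _.
have M'M : M' `<=` M by apply: gen_sub.
have KM' : adjoin M t `<=` adjoin M' t.
  by rewrite KE; apply: gen_sub => //; apply: subgroup_adjoin.
have [U [UM Ut]] := powers_in_subgroup t sM.
exists (T ++ U); apply/seteqP; split; last first.
  by apply: gen_sub => // z; rewrite /= mem_cat => /orP[/TM|/UM].
move=> x Mx; have [a [b [y [M'y xE]]]] := KM' _ (sub_adjoin t Mx).
rewrite xE; apply: subgroupM (subgroup_gen _) _ _.
  have: generated [set` U] (t ^- a * t ^+ b).
    by apply: Ut; apply: (subgroupMr sM (M'M _ M'y)); rewrite -xE.
  by apply: genS => z zU; rewrite /= mem_cat zU orbT.
by move: M'y; apply: genS => z zT; rewrite /= mem_cat zT.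
Qed.

End CyclicExtensions.

(** * A contained fire rules out free semigroups *)

Section Counting.
Local Open Scope group_scope.
Local Open Scope card_scope.

Lemma card_le_size (T : finType) (U : eqType) (f : T -> U) (A : {set T}) (l : seq U) :
  {in A &, injective f} -> (forall x, x \in A -> f x \in l) -> (#|A| <= size l)%N.
Proof.
move=> fI fl; rewrite cardE -(size_map f); apply: uniq_leq_size.
  rewrite map_inj_in_uniq ?enum_uniq // => x y; rewrite !mem_enum; exact: fI.
by move=> y /mapP[x]; rewrite mem_enum => /fl xl ->.
Qed.

Lemma card_le_seq (T : choiceType) (A : set T) n : A #<= `I_n ->
  exists2 l : seq T, (size l <= n)%N & A `<=` [set` l].
Proof.
move=> An; have fA : finite_set A by apply/finite_set_leP; exists n.
exists (enum_fset (fset_set A)); last by move=> x Ax; rewrite /= in_fset_set // mem_set.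
exact: geq_card_fset_set.
Qed.

(** Bernoulli's inequality, in the form (1 + 1 / n) ^ D <= 1 / (1 - D / n). *)
Lemma expSn_le D n : (n.+1 ^ D * (n - D) <= n ^ D.+1)%N.
Proof.
elim: D => [|D IH]; first by rewrite expn0 mul1n expn1 subn0.
rewrite (expnS n D.+1) (expnS n.+1).
apply: leq_trans (leq_mul (leqnn n) IH).
rewrite -mulnA mulnCA (mulnCA n) leq_mul2l; apply/orP; right.
by have [nD|Dn] := leqP n D; [rewrite (_ : n - D.+1 = 0)%N|]; nia.
Qed.

(** A large multiple q of a polynomial of higher degree than the error satisfies
    q j.+1 + error <= 2 * q j, so it stays below any such sequence N that starts
    above it. *)
Lemma doubling_unbounded E D : exists N0, forall N : nat -> nat, (N0 <= N 0)%N ->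
  (forall j, 2 * N j <= N j.+1 + E * j.+1 ^ D)%N -> forall j, (j <= N j)%N.
Proof.
(* The shift by 3 * D.+1 makes one step of j multiply the power by at most
   3 / 2. *)
pose q j := (2 * E.+1 * (j + 3 * D.+1) ^ D.+1)%N.
have qS j : (q j.+1 + E * j.+1 ^ D <= 2 * q j)%N.
  pose n := (j + 3 * D.+1)%N; rewrite /q -/n addSn -/n.
  have h1 := expSn_le D.+1 n.
  have h2 : (2 * n <= 3 * (n - D.+1))%N by rewrite /n; lia.
  have h3 : (2 * n.+1 ^ D.+1 <= 3 * n ^ D.+1)%N.
    rewrite -(@leq_pmul2r n); last by rewrite /n; lia.
    have := leq_mul (leqnn (n.+1 ^ D.+1)) h2; move: h1; rewrite (expnS n D.+1).
    set A := (n.+1 ^ _)%N; set B := (n ^ _)%N; nia.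
  have h4 : (E * j.+1 ^ D <= E.+1 * n ^ D.+1)%N.
    apply: leq_mul => //; apply: (@leq_trans (n ^ D)%N).
      by case: (D) => // D'; rewrite leq_exp2r // /n; lia.
    by rewrite expnS leq_pmull // /n; lia.
  rewrite -mulnA; move: h3 h4; set A := (_ ^ _)%N; set B := (n ^ _)%N; nia.
exists (q 0%N) => N N0 NS j; apply: (@leq_trans (q j)).
  rewrite /q expnS; have : (0 < (j + 3 * D.+1) ^ D)%N by rewrite expn_gt0; lia.
  by nia.
elim: j => // j IH; move: (qS j) (NS j); lia.
Qed.

End Counting.

Section GraphDistance.
Local Open Scope group_scope.
Local Open Scope card_scope.
Variable X : graph.
Implicit Types (x y : X) (W : nat -> set X).

Lemma dist_le1 x y : (dist x y <= 1)%N <-> x = y \/ adj x y.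
Proof.
rewrite /dist; case: ex_minnP => n /asboolP[p [px py pn]] nmin; split.
  case: p px py pn => [|z [|? ?]] /=; first by left.
    by rewrite andbT => xz <- _; right.
  by move=> _ _ <-.
case=> [xy|xy]; last by apply: nmin; apply/asboolP; exists [:: y]; rewrite /= xy.
by apply: leq_trans (nmin 0%N _) _ => //; apply/asboolP; exists [::].
Qed.

Lemma containment_seq_finite W (X0 : set X) n :
  finite_set X0 -> finite_set (containment_seq W X0 n).
Proof.
move=> fX; elim: n => //= n IH.
apply: (@sub_finite_set _ _ (containment_seq W X0 n `|`
  \bigcup_(u in containment_seq W X0 n) [set y | adj u y])).
  move=> v [[u Xu /dist_le1[->|vu]] _]; first by left.
  by right; exists u => //=; rewrite adj_sym.
rewrite finite_setU; split=> //; apply: bigcup_finite => // u _.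
exact: adj_locally_finite.
Qed.

End GraphDistance.

Section Fire.
Local Open Scope group_scope.
Local Open Scope card_scope.
Variable G : groupType.
Variable S : seq G.
Hypothesis genS : generates S.
Let X := cayley_graph genS.

Lemma dist_mull (g x y : X) : (dist x y <= 1)%N ->
  (dist ((g : G) * (x : G) : X)%g ((g : G) * (y : G) : X)%g <= 1)%N.
Proof.
move=> /dist_le1[->|xy]; apply/dist_le1; [by left|right].
move: xy; rewrite /adj /= /cayley_adj /= !invgM -!mulgA !mulKg.
by rewrite (inj_eq (mulgI g)).
Qed.

(** Walks that stay at their end point, so that walks of different lengths can
    be followed at the same pace. *)
Lemma walk_to (c : G) : exists (z : nat -> G) (l : nat),
  [/\ z 0%N = 1, forall n, (l <= n)%N -> z n = c
    & forall i, (dist (z i.+1 : X) (z i : X) <= 1)%N].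
Proof.
have [p [p1 pc]] := @adj_connected X (1 : G) c.
have nl : nth c (1 :: p) (size p) = c by apply: etrans (nth_last c (1 :: p)) pc.
have nd n : (size p <= n)%N -> nth c (1 :: p) n = c.
  by rewrite leq_eqVlt => /predU1P[<-//|pn]; rewrite nth_default.
exists (nth c (1 :: p)), (size p); split=> // i.
apply/dist_le1; have [ip|pi] := ltnP i (size p).
  by right; rewrite adj_sym; move: p1 => /(pathP c)/(_ i ip).
by left; rewrite !nd //; apply: leqW.
Qed.

Lemma wordval_rcons (a b : G) u c :
  wordval a b (rcons u c) = wordval a b u * (if c then b else a).
Proof. by elim: u => [|d u IH] /=; rewrite ?mulg1 ?mul1g // IH mulgA. Qed.

(** A free semigroup on a and b gives a binary tree whose edges are walks of
    length L.  A protected vertex meets boundedly many of these walks on each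
    level, so the number of burning vertices of the tree doubles every L steps,
    up to a polynomial error. *)
Lemma containment_no_free_semigroup d : graph_containment X d -> no_free_semigroup G.
Proof.
move=> [C C0 contX] a b; apply: contrapT => /forallNP nab.
have inj u v : size u = size v -> wordval a b u = wordval a b v -> u = v.
  by move=> uv e; apply: contrapT => ne; apply: (nab u); exists v.
have [z [L [L0 z0 zL zS]]] : exists (z : bool -> nat -> G) (L : nat),
    [/\ (0 < L)%N, forall c, z c 0%N = 1, forall c, z c L = if c then b else a
      & forall c i, (dist (z c i.+1 : X) (z c i : X) <= 1)%N].
  have [za [la [za0 zal zaS]]] := walk_to a.
  have [zb [lb [zb0 zbl zbS]]] := walk_to b.
  exists (fun c => if c then zb else za), (la + lb).+1.
  by split=> // -[] //; [apply: zbl|apply: zal]; lia.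
pose E := (2 * L.+1 * (C * L ^ d.+1))%N.
have [r rP] := doubling_unbounded E d.+1.
pose X0 : set X := [set wordval a b w | w in [set w : seq bool | size w == r]].
have fX0 : finite_set X0.
  apply: (@sub_finite_set _ _ [set` [seq wordval a b w | w : r.-tuple bool]]).
    move=> _ [w /= wr <-]; apply/mapP; exists (Tuple wr) => //.
    by rewrite mem_enum.
  exact: finite_seq.
have [W [WC _ [T T0 XT]]] := contX X0 fX0.
set F := containment_seq W X0 in XT.
have [Wl WlC WlW] : exists2 Wl : nat -> seq G,
    forall i, (1 <= i)%N -> (size (Wl i) <= C * i ^ d)%N &
    forall i, (1 <= i)%N -> W i `<=` [set` Wl i].
  have /choice[Wl H] : forall i, exists l : seq G, (1 <= i)%N ->
      (size l <= C * i ^ d)%N /\ W i `<=` [set` l].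
    by case=> [|i]; [exists [::]|have [l ? ?] := card_le_seq (WC i.+1 isT); exists l].
  by exists Wl => i /H[].
pose protected j := flatten [seq Wl i | i <- iota 1 (L * j)].
have protected_size j : (size (protected j.+1) <= C * L ^ d.+1 * j.+1 ^ d.+1)%N.
  have sizeW (s : seq nat) : {in s, forall i, 1 <= i <= L * j.+1}%N ->
      (size (flatten [seq Wl i | i <- s]) <= size s * (C * (L * j.+1) ^ d))%N.
    elim: s => //= i s IH si; rewrite size_cat mulSn leq_add //; last first.
      by apply: IH => k ks; apply: si; rewrite inE ks orbT.
    have /andP[i1 iL] := si i (mem_head _ _).
    apply: leq_trans (WlC i i1) _; rewrite leq_mul2l; apply/orP; right.
    by case: (d) => // e; rewrite leq_exp2r.
  apply: leq_trans (sizeW _ _) _; first by move=> i; rewrite mem_iota; lia.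
  rewrite size_iota mulnCA -expnS expnMn; lia.
have protectedW j i : (1 <= i <= L * j)%N -> W i `<=` [set` protected j].
  move=> ij x Wx; apply/flattenP; exists (Wl i); last by apply: WlW => //; lia.
  by apply: map_f; rewrite mem_iota; lia.
(* B j is the set of burning vertices of the tree on level j + r, L j steps after
   the fire starts on level r. *)
pose B j : {set (j + r).-tuple bool} :=
  [set w : (j + r).-tuple bool | `[< F (L * j)%N (wordval a b w) >]]%SET.
have step j : (2 * #|B j| <= #|B j.+1| + E * j.+1 ^ d.+1)%N.
  pose P : {set (j + r).-tuple bool * bool} := finset.setX (B j) [set: bool]%SET.
  pose A : {set (j + r).-tuple bool * bool} :=
    [set wc | rcons_tuple wc.1 wc.2 \in B j.+1]%SET.
  have PE : #|P| = (2 * #|B j|)%N by rewrite /P cardsX cardsT card_bool mulnC.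
  rewrite -PE -(cardsID A); apply: leq_add.
    rewrite [leqRHS]cardE; apply: (@card_le_size _ _ (fun wc => rcons_tuple wc.1 wc.2)).
      move=> [u c] [v e] _ _ /(congr1 val) /= /eqP.
      by rewrite eqseq_rcons => /andP[/eqP/val_inj -> /eqP ->].
    by move=> wc; rewrite mem_enum => /setIP[_]; rewrite [wc \in A]inE.
  (* An edge of the tree that does not transmit the fire meets a protected vertex;
     the edge is determined by its label, this vertex, and its position. *)
  pose hit (wc : (j + r).-tuple bool * bool) :=
    [pred i | wordval a b wc.1 * z wc.2 i \in protected j.+1].
  have hitP wc : wc \in P :\: A -> has (hit wc) (iota 0 L.+1).
    case: wc => w c wPA; apply: contraT => /hasPn nhit.
    move: wPA; rewrite !inE /= => /andP[/negP Aw /andP[/asboolP Fw _]].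
    case: Aw; apply/asboolP; rewrite wordval_rcons -zL.
    have fire i : (i <= L)%N -> F (L * j + i)%N (wordval a b w * z c i).
      elim: i => [_|i IH iL]; first by rewrite addn0 z0 mulg1.
      rewrite addnS; split; first by exists (wordval a b w * z c i);
        [apply: IH; apply: ltnW|apply: dist_mull].
      have /negP nV : ~~ hit (w, c) i.+1 by apply: nhit; rewrite mem_iota.
      by move=> k kL Wk; apply: nV; apply: protectedW Wk; rewrite mulnS; lia.
    by rewrite mulnS addnC; apply: fire.
  pose f (wc : (j + r).-tuple bool * bool) :=
    (wc.2, find (hit wc) (iota 0 L.+1),
     wordval a b wc.1 * z wc.2 (find (hit wc) (iota 0 L.+1))).
  pose l := [seq (ci, y) | ci <- [seq (c, i) | c <- [:: true; false], i <- iota 0 L.+1],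
                            y <- protected j.+1].
  apply: (@leq_trans (size l)); last first.
    rewrite /l !size_allpairs size_iota /E -(mulnA (2 * L.+1)%N).
    exact: leq_mul (leqnn _) (protected_size j).
  apply: (@card_le_size _ _ f) => [[u c] [v e] _ _ [<- <- /mulIg uv]|[w c] /hitP]; last rewrite /f.
    by congr (_, _); apply/val_inj/inj => //; rewrite !size_tuple.
  set i := find _ _ => h; have iL : (i < L.+1)%N by move: h; rewrite has_find size_iota.
  have := nth_find 0%N h; rewrite -/i nth_iota // add0n => hiti.
  apply/allpairsP; exists ((c, i), wordval a b w * z c i); split=> //.
  by apply/allpairsP; exists (c, i); split; rewrite ?mem_iota //; case: (c).
have B0 : (r <= #|B 0%N|)%N.
  rewrite (_ : B 0%N = [set: r.-tuple bool]%SET); last first.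
    apply/setP => w; rewrite !inE; apply/asboolP; rewrite muln0.
    by exists w => //=; rewrite size_tuple.
  by rewrite cardsT card_tuple card_bool; apply/ltnW/ltn_expl.
have Bj := rP (fun j => #|B j|) B0 step.
have [l Xl] : exists l : seq G, F T `<=` [set` l].
  have /finite_fsetP[l ->] : finite_set (F T) by apply: containment_seq_finite.
  by exists l.
pose j := (T + (size l).+1)%N.
have : (#|B j| <= size l)%N.
  apply: (@card_le_size _ _ (fun w : (j + r).-tuple bool => wordval a b w)).
    by move=> u v _ _ uv; apply/val_inj/inj => //; rewrite !size_tuple.
  move=> w; rewrite inE => /asboolP; rewrite XT; first exact: Xl.
  by rewrite /j; nia.
by have := Bj j; rewrite /j; lia.
Qed.

End Fire.

(** * Integer polynomials acting on an abelian group *)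

Section PolynomialAction.
Local Open Scope ring_scope.
Variables (V : zmodType) (tau : {additive V -> V}).
Implicit Types (p q : {poly int}) (v w : V) (n : nat).

(** The action p(tau) v of Z[X] on V. *)
Definition pact p v : V := \sum_(i < size p) iter i tau v *~ p`_i.

Lemma iter_tauD n : {morph iter n tau : v w / v + w}.
Proof. by elim: n => // n IH v w; rewrite /= IH raddfD. Qed.

Lemma pact_widen n p v :
  (size p <= n)%N -> pact p v = \sum_(i < n) iter i tau v *~ p`_i.
Proof.
move=> pn; rewrite /pact -[LHS](big_mkord xpredT (fun i => iter i tau v *~ p`_i)).
rewrite -[RHS](big_mkord xpredT (fun i => iter i tau v *~ p`_i)).
rewrite (@big_cat_nat _ _ _ (size p) 0%N n) //= [X in _ = _ + X]big1_seq ?addr0 //.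
move=> i /andP[_]; rewrite mem_index_iota => /andP[pi _].
by rewrite nth_default // mulr0z.
Qed.

Lemma pactD p q v : pact (p + q) v = pact p v + pact q v.
Proof.
rewrite (pact_widen v (leq_maxl (size p) (size q))).
rewrite (pact_widen v (leq_maxr (size p) (size q))).
rewrite (pact_widen v (size_polyD p q)) -big_split /=.
by apply: eq_bigr => i _; rewrite coefD mulrzDr.
Qed.

Lemma pact0 v : pact 0 v = 0.
Proof. by rewrite /pact size_poly0 big_ord0. Qed.

Lemma pactN p v : pact (- p) v = - pact p v.
Proof. by apply/eqP; rewrite -addr_eq0 -pactD addNr pact0. Qed.

Lemma pactDr p : {morph pact p : v w / v + w}.
Proof.
move=> v w; rewrite /pact -big_split /=; apply: eq_bigr => i _.
by rewrite iter_tauD mulrzDl.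
Qed.

Lemma pact0r p : pact p 0 = 0.
Proof. by apply: (addIr (pact p 0)); rewrite add0r -pactDr addr0. Qed.

Lemma pactC c v : pact c%:P v = v *~ c.
Proof. by rewrite (@pact_widen 1) ?size_polyC_leq1 // big_ord1 coefC eqxx. Qed.

Lemma pact1 v : pact 1 v = v.
Proof. by rewrite pactC mulr1z. Qed.

Lemma pact_MX p v : pact (p * 'X) v = tau (pact p v).
Proof.
rewrite (@pact_widen (size p).+1); last first.
  by rewrite (leq_trans (size_polyMleq _ _)) // size_polyX addn2.
rewrite big_ord_recl coefMX /= mulr0z add0r raddf_sum; apply: eq_bigr => i _.
by rewrite coefMX /= raddfMz.
Qed.

Lemma pactM p q v : pact (p * q) v = pact p (pact q v).
Proof.
elim/poly_ind: p => [|p c IH]; first by rewrite mul0r !pact0.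
rewrite mulrDl mulrAC !pactD !pact_MX IH pactC; congr (_ + _).
elim/poly_ind: q {IH} => [|q d IH]; first by rewrite mulr0 !pact0 mul0rz.
rewrite mulrDr mulrA !pactD !pact_MX IH raddfMz mulrzDl; congr (_ + _).
by rewrite -polyCM !pactC mulrC mulrzA.
Qed.

Lemma pactXn n v : pact 'X^n v = iter n tau v.
Proof.
elim: n => [|n IH]; first by rewrite expr0 pact1.
by rewrite exprSr pact_MX IH.
Qed.

End PolynomialAction.

(** * Kronecker's theorem *)

Section IntegerPolynomials.
Local Open Scope ring_scope.
Implicit Types (p q F D : {poly int}) (x y z : algC).

Local Notation pZtoQ := (map_poly (intr : int -> rat)).
Local Notation pZtoC := (map_poly (intr : int -> algC)).
Local Notation pQtoC := (map_poly (ratr : rat -> algC)).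

Lemma pZtoQtoC p : pQtoC (pZtoQ p) = pZtoC p.
Proof. by rewrite -map_poly_comp; apply: eq_map_poly => b; rewrite /= rmorph_int. Qed.

Lemma nat_pigeonhole (T : finType) (f : nat -> T) : exists i j, (i < j)%N /\ f i = f j.
Proof.
apply: contrapT => H; have fI : injective (fun i : 'I_(#|T|.+1) => f i).
  move=> i j ij; apply/val_inj; have [lt|lt|//] := ltngtP i j; case: H.
    by exists i, j.
  by exists j, i.
by have := leq_card _ fI; rewrite card_ord ltnn.
Qed.

(** Bernoulli's inequality: the powers of 1 + d grow at least linearly. *)
Lemma bounded_powers_le1 (x : algC) :
  0 <= x -> (forall k, (0 < k)%N -> x ^+ k < 2) -> x <= 1.
Proof.
move=> x0 xk; rewrite real_leNgt ?ger0_real //; apply/negP => x1.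
pose d := x - 1; have d0 : 0 < d by rewrite subr_gt0.
have bern k : 1 + d *+ k <= x ^+ k.
  elim: k => [|k IH]; first by rewrite mulr0n addr0 expr0.
  have -> : x = 1 + d by rewrite /d addrC subrK.
  rewrite exprS mulrDl mul1r mulrS (addrC d) addrA -/d.
  have xE : 1 + d = x by rewrite /d addrC subrK.
  rewrite xE; apply: lerD => //; rewrite ler_peMr ?(ltW d0) //.
  by apply: exprn_ege1; apply: ltW.
pose k := Num.Def.archi_bound d^-1.
have dk : d^-1 < k%:R by apply: archi_boundP; rewrite invr_ge0 ltW.
have k0 : (0 < k)%N.
  by rewrite lt0n; apply: contraTneq dk => ->; rewrite le_gtF // invr_ge0 ltW.
have : 1 + d *+ k < 2 by apply: le_lt_trans (xk k k0).
rewrite -[2]/(1 + 1) ltrD2l -mulr_natr mulrC -ltr_pdivlMr // div1r => kd.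
by have := lt_trans dk kd; rewrite ltxx.
Qed.

Lemma geom_lt (x : algC) n : 2 <= x -> \sum_(i < n) x ^+ i < x ^+ n.
Proof.
move=> x2; elim: n => [|n IH]; first by rewrite big_ord0 expr0 ltr01.
rewrite big_ord_recr /= exprS.
have xn : 0 <= x ^+ n by apply: exprn_ge0; apply: le_trans x2; rewrite ler0n.
apply: (@lt_le_trans _ _ (2 * x ^+ n)); last exact: ler_wpM2r.
by rewrite mulrDl mul1r ltrD2r.
Qed.

(** The leading coefficient is a unit, and the other terms are too small to
    cancel it outside the disc of radius 2. *)
Lemma root_norm_lt2 F z : F != 0 -> (forall i, `|F`_i| <= 1) ->
  root (pZtoC F) z -> `|z| < 2.
Proof.
move=> F0 F1; rewrite rootE horner_coef size_map_inj_poly //; last exact: intr_inj.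
have [n sF] : exists n, size F = n.+1.
  by exists (size F).-1; rewrite prednK // lt0n size_poly_eq0.
rewrite sF big_ord_recr /= => /eqP e.
rewrite real_ltNge ?normr_real ?realn //; apply/negP => z2.
have lc : (`|(F`_n)%:~R : algC| = 1).
  have : F`_n != 0 by rewrite -[n]/(n.+1.-1) -sF lead_coef_eq0.
  move=> Fn; have -> : `|(F`_n)%:~R : algC| = (`|F`_n|)%:~R by rewrite intr_norm.
  by have -> : `|F`_n| = 1 by move: (F1 n) Fn; lia.
have zn : `|z| ^+ n <= \sum_(i < n) `|z| ^+ i.
  move: e; rewrite addrC coef_map /= => /eqP; rewrite addr_eq0 => /eqP.
  move/(congr1 Num.norm); rewrite normrM lc mul1r normrN normrX => ->.
  apply: le_trans (ler_norm_sum _ _ _) _; apply: ler_sum => i _.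
  rewrite normrM normrX coef_map /= ler_piMl ?exprn_ge0 //.
  by rewrite -intr_norm lerz1 F1.
by have := lt_le_trans (geom_lt n z2) zn; rewrite ltxx.
Qed.

(** The minimal polynomial over Q is irreducible, and its derivative is a nonzero
    polynomial of smaller degree. *)
Lemma minCpoly_separable x : separable_poly (minCpoly x).
Proof.
have [p [pE mon_p] dv_p] := minCpolyP x.
have p0 := monic_neq0 mon_p.
have p1 : (1 < size p)%N by rewrite -(size_map_poly (ratr : rat -> algC)) -pE size_minCpoly.
have irr : irreducible_poly p.
  split=> // r r1 /dvdpP[s pE']; have px := root_minCpoly x.
  have [s0 r0] : s != 0 /\ r != 0.
    by move: p0; rewrite pE' mulf_eq0 negb_or => /andP[].
  move: px; rewrite pE pE' rmorphM rootM !dv_p => /orP[ps|pr]; last first.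
    by rewrite -pE' /eqp pr andbT pE' dvdp_mull.
  have := dvdp_leq s0 ps; rewrite pE' size_mul // => sz.
  have : (0 < size s)%N by rewrite lt0n size_poly_eq0.
  have : (0 < size r)%N by rewrite lt0n size_poly_eq0.
  have /eqP : size r != 1%N := r1; move: sz.
  move: (size s) (size r) => a b *; exfalso; lia.
rewrite pE separable_map separable_poly.unlock irreducible_poly_coprime //.
rewrite gtNdvdp ?lt_size_deriv //; apply/eqP => /polyP/(_ (size p).-2).
rewrite coef_deriv coef0 => /eqP; rewrite mulrn_eq0 /=.
have -> : (size p).-2.+1 = (size p).-1 by lia.
by rewrite -lead_coefE lead_coef_eq0 (negbTE p0).
Qed.

(** Kronecker's theorem.  Powers of x are integral combinations of its first
    powers; by interpolation at the conjugates, which are distinct, bounded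
    conjugates give bounded coefficients, so two powers of x coincide. *)
Lemma kronecker x : x \in Aint -> x != 0 ->
  (forall y, root (minCpoly x) y -> `|y| <= 1) -> exists2 N, (0 < N)%N & x ^+ N = 1.
Proof.
move=> /floorpP[q qE] x0 conj1.
have mon_q : q \is monic.
  have := minCpoly_monic x; rewrite qE !monicE lead_coef_map_inj //; last exact: intr_inj.
  by rewrite -[1]/(1%:~R : algC) eqr_int.
have [rs rsE] := closed_field_poly_normal (minCpoly x).
rewrite (monicP (minCpoly_monic x)) scale1r in rsE.
have rs_uniq : uniq rs by rewrite -separable_prod_XsubC -rsE minCpoly_separable.
have rsP y : (y \in rs) = root (minCpoly x) y by rewrite rsE root_prod_XsubC.
pose n := size rs.
have sq : size q = n.+1.
  rewrite -(@size_map_inj_poly _ _ (intr : int -> algC)) //; last exact: intr_inj.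
  by rewrite -qE rsE size_prod_XsubC.
have rem k : {r : {poly int} | (size r <= n)%N /\
    forall y, y \in rs -> (pZtoC r).[y] = y ^+ k}.
  exists (Pdiv.CommonRing.rmodp 'X^k q); split.
    by rewrite -ltnS -sq Pdiv.CommonRing.ltn_rmodp monic_neq0.
  move=> y; rewrite rsP qE => /rootP qy.
  have /(congr1 (fun p => (pZtoC p).[y])) := Pdiv.RingMonic.rdivp_eq mon_q 'X^k.
  by rewrite rmorphD rmorphM /= map_polyXn hornerD hornerM qy mulr0 add0r hornerXn.
pose r k := sval (rem k).
have rP k : (size (r k) <= n)%N /\ forall y, y \in rs -> (pZtoC (r k)).[y] = y ^+ k.
  exact: svalP (rem k).
pose a : 'rV[algC]_n := \row_j rs`_j.
have Vu : Vandermonde n a \in unitmx.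
  rewrite unitmxE det_Vandermonde unitfE; apply/prodf_neq0 => i _.
  apply/prodf_neq0 => j ij; rewrite !mxE subr_eq0 nth_uniq //.
  by apply: contraTneq ij => /eqP; rewrite eq_sym; lia.
(* Interpolation: M recovers the coefficients of a remainder from its values. *)
pose M := invmx (Vandermonde n a); pose B : algC := \sum_(j < n) \sum_(i < n) `|M j i|.
have coefB k (i : 'I_n) : `|((r k)`_i)%:~R : algC| <= B.
  have [sr rE] := rP k; pose u : 'rV[algC]_n := \row_i ((r k)`_i)%:~R.
  pose w : 'rV[algC]_n := \row_j rs`_j ^+ k.
  have uV : u *m Vandermonde n a = w.
    apply/rowP => j; rewrite !mxE -rE ?mem_nth // (@horner_coef_wide _ n); last first.
      by rewrite size_map_inj_poly //; apply: intr_inj.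
    by apply: eq_bigr => l _; rewrite !mxE coef_map.
  have -> : ((r k)`_i)%:~R = (w *m M) 0 i by rewrite -uV mulmxK // mxE.
  rewrite mxE; apply: le_trans (ler_norm_sum _ _ _) _; apply: ler_sum => j _.
  rewrite (bigD1 i) //= normrM mxE.
  rewrite -[X in X <= _]addr0; apply: lerD; last exact: sumr_ge0.
  by rewrite ler_piMl // normrX exprn_ile1 // conj1 // -rsP mem_nth.
pose b := Num.Def.archi_bound B.
have B0 : 0 <= B by apply: sumr_ge0 => j _; apply: sumr_ge0.
have coefb k (i : 'I_n) : `|(r k)`_i| < b.
  have := le_lt_trans (coefB k i) (archi_boundP B0).
  by rewrite -intr_norm pmulrn ltr_int.
pose f k : {ffun 'I_n -> 'I_(b + b).+1} := [ffun i : 'I_n => inord (absz ((r k)`_i + b%:Z))].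
have [k [l [kl fkl]]] := nat_pigeonhole f.
have rkl : r k = r l.
  apply/polyP => i; have [i_n|ni] := ltnP i n; last first.
    have [[sk _] [sl _]] := (rP k, rP l).
    by rewrite !nth_default //; [apply: leq_trans ni|apply: leq_trans ni].
  have /ffunP/(_ (Ordinal i_n))/(congr1 val) := fkl; rewrite !ffunE /=.
  have := coefb k (Ordinal i_n); have := coefb l (Ordinal i_n); rewrite /= => h1 h2.
  by rewrite !inordK; lia.
have xrs : x \in rs by rewrite rsP root_minCpoly.
exists (l - k)%N; first by rewrite subn_gt0.
have := (rP k).2 x xrs; rewrite rkl (rP l).2 // -{1}(subnK (ltnW kl)) exprD.
move=> e; apply: (mulIf (expf_neq0 k x0)); by rewrite mul1r.
Qed.

End IntegerPolynomials.

(** * Quasi-unipotent automorphisms *)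

Section QuasiUnipotent.
Local Open Scope ring_scope.
Variables (V : zmodType) (tau : {additive V -> V}) (l : seq V).
Implicit Types (p q F G D : {poly int}) (v w : V).

Local Notation pZtoC := (map_poly (intr : int -> algC)).

Hypothesis tau_inj : injective tau.
Hypothesis span_l : forall H : V -> Prop, H 0 ->
  (forall v w, H v -> H w -> H (v - w)) -> (forall v, v \in l -> H v) -> forall v, H v.
Hypothesis relations : forall k v, (0 < k)%N -> exists F,
  [/\ F != 0, forall i, `|F`_i| <= 1 & pact tau (F \Po 'X^k) v = 0].

Let kills p := forall v, pact tau p v = 0.

Let pactBr p v w : pact tau p (v - w) = pact tau p v - pact tau p w.
Proof. by apply: (addIr (pact tau p w)); rewrite -pactDr !subrK. Qed.

Let kills_gens p : (forall v, v \in l -> pact tau p v = 0) -> kills p.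
Proof.
apply: span_l => [|v w Hv Hw]; first exact: pact0r.
by rewrite pactBr Hv Hw subrr.
Qed.

Let kills_Ml p q : kills q -> kills (p * q).
Proof. by move=> kq v; rewrite pactM kq pact0r. Qed.

Let kills_D p q : kills p -> kills q -> kills (p + q).
Proof. by move=> kp kq v; rewrite pactD kp kq addr0. Qed.

(** The product of the relations of the generators of V kills V. *)
Let kills_small_roots k : (0 < k)%N -> exists G,
  [/\ kills (G \Po 'X^k), `|lead_coef G| = 1
    & forall z : algC, root (pZtoC G) z -> `|z| < 2].
Proof.
move=> k0; have [G [kG lG zG]] : exists G,
  [/\ forall v, v \in l -> pact tau (G \Po 'X^k) v = 0, `|lead_coef G| = 1
    & forall z : algC, root (pZtoC G) z -> `|z| < 2].
  elim: (l) => [|a s [G [kG lG zG]]].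
    exists 1; rewrite lead_coef1; split=> [v|//|z]; first by rewrite in_nil.
    by rewrite rmorph1 (negPf (root1 _)).
  have [F [F0 F1 Fa]] := relations a k0.
  exists (F * G); split=> [v||z].
  - rewrite inE comp_polyM => /predU1P[->|vs]; first by rewrite mulrC pactM Fa pact0r.
    by rewrite pactM kG // pact0r.
  - rewrite lead_coefM normrM lG mulr1.
    move: F0 (F1 (size F).-1); rewrite -lead_coefE -lead_coef_eq0.
    by move: (lead_coef F : int) => c c0 c1; lia.
  - by rewrite rmorphM rootM => /orP[/root_norm_lt2->|/zG].
by exists G; split=> //; apply: kills_gens.
Qed.

(** Take a nonzero polynomial of least degree that kills V, and reduce the others
    modulo it by pseudo-division.  As tau is injective, a factor X could be
    cancelled, so 0 is not a root. *)
Let min_annihilator : exists D,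
  [/\ D != 0, kills D, ~~ root D 0 & forall p, kills p -> D %| p].
Proof.
have [G [kG lG _]] := kills_small_roots (ltn0Sn 0).
have ex : exists n, `[< exists p, [/\ p != 0, kills p & size p = n] >].
  exists (size (G \Po 'X^1)); apply/asboolP; exists (G \Po 'X^1); split=> //.
  by rewrite expr1 comp_polyXr -lead_coef_eq0; apply/eqP => G0; rewrite G0 in lG.
case: (ex_minnP ex) => n /asboolP[D [D0 kD sD]] nmin.
have small p : kills p -> (size p < size D)%N -> p = 0.
  move=> kp; rewrite sD; have [//|p0] := eqVneq p 0; rewrite ltnNge => /negP[].
  by apply: nmin; apply/asboolP; exists p.
exists D; split=> // [|p kp].
  apply/negP => /factor_theorem[q]; rewrite subr0 => DE.
  have kq : kills q.
    by move=> v; apply: tau_inj; rewrite raddf0 -pact_MX -DE.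
  have q0 : q != 0 by apply: contraNneq D0 => q0; rewrite DE q0 mul0r.
  by have /eqP := q0; apply; apply: small => //; rewrite DE size_mulX.
apply/modp_eq0P; apply: small; last by rewrite Pdiv.Idomain.ltn_modp.
have : kills (lead_coef D ^+ scalp p D *: p - p %/ D * D).
  rewrite -mul_polyC -mulNr; apply: kills_D; exact: kills_Ml.
by rewrite Pdiv.Idomain.divp_eq addrC addKr.
Qed.

(** A conjugate y of x is a root of every polynomial that kills V, in particular
    of those provided by [kills_small_roots], so all powers of y are less than 2
    in norm. *)
Let roots_of_unity D (x : algC) : D != 0 -> ~~ root D 0 ->
  (forall p, kills p -> D %| p) -> root (pZtoC D) x ->
  exists2 N, (0 < N)%N & x ^+ N = 1.
Proof.
move=> D0 D00 dvD Dx.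
have killsx p : kills p -> root (pZtoC p) x.
  move=> /dvD/Pdiv.Idomain.dvdpP[[c r] c0 /(congr1 pZtoC)] /= e.
  have : root (pZtoC (c *: p)) x by rewrite e rmorphM rootM Dx orbT.
  by rewrite map_polyZ rootZ // intr_eq0.
have conj_small y k : root (minCpoly x) y -> (0 < k)%N -> `|y| ^+ k < 2.
  move=> xy k0; have [G [kG _ zG]] := kills_small_roots k0.
  have [q [qE _] dvq] := minCpolyP x.
  have : root (pZtoC (G \Po 'X^k)) y.
    have := killsx _ kG; rewrite -!pZtoQtoC dvq => /dvdpP[r ->].
    by rewrite rmorphM /= rootM -qE xy orbT.
  rewrite map_comp_poly map_polyXn /root horner_comp hornerXn -normrX.
  exact: zG.
apply: kronecker.
- have [G [kG lG _]] := kills_small_roots (ltn0Sn 0).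
  rewrite expr1 comp_polyXr in kG.
  wlog lG1 : G kG {lG} / lead_coef G = 1 => [W|].
    have [G1|G1] : lead_coef G = 1 \/ lead_coef (- G) = 1.
      by rewrite lead_coefN; move: lG; move: (lead_coef G : int) => c; lia.
    - exact: (W G).
    - by apply: (W (- G)) => // v; rewrite pactN kG oppr0.
  apply: root_monic_Aint (killsx _ kG) _ _.
    by rewrite monicE lead_coef_map_inj ?lG1 //; apply: intr_inj.
  by apply/polyOverP => i; rewrite coef_map /= intr_int.
- apply: contraNneq D00 => x0; move: Dx; rewrite x0 /root -[0]/(0%:~R) horner_map /=.
  by rewrite intr_eq0.
- by move=> y xy; apply: bounded_powers_le1 => // k; apply: conj_small.
Qed.

(** Over algC, D divides a power of X ^ N - 1; the divisibility
    descends to Q, and costs an integer factor c over Z. *)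
Let annihilator_torsion : exists N m (c : int), [/\ (0 < N)%N, c != 0
  & forall v, pact tau (('X^N - 1) ^+ m) v *~ c = 0].
Proof.
have [D [D0 kD D00 dvD]] := min_annihilator.
have CD0 : pZtoC D != 0.
  by rewrite -size_poly_eq0 size_map_inj_poly ?size_poly_eq0 //; apply: intr_inj.
have [rs rsE] := closed_field_poly_normal (pZtoC D).
have rsD x : x \in rs -> root (pZtoC D) x.
  by move=> xrs; rewrite rsE rootZ ?root_prod_XsubC // lead_coef_eq0.
have [N N0 rsN] : exists2 N, (0 < N)%N & forall x, x \in rs -> x ^+ N = 1.
  elim: rs rsD {rsE} => [|x s IH] rsD; first by exists 1%N.
  have [|N N0 sN] := IH; first by move=> y ys; apply: rsD; rewrite inE ys orbT.
  have [M M0 xM] := roots_of_unity D0 D00 dvD (rsD x (mem_head _ _)).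
  exists (M * N)%N; first by rewrite muln_gt0 M0.
  move=> y; rewrite inE => /predU1P[->|ys]; first by rewrite exprM xM expr1n.
  by rewrite mulnC exprM sN ?expr1n.
exists N, (size rs).
have /Pdiv.Idomain.dvdpP[[c r] /= c0 e] : D %| ('X^N - 1) ^+ size rs.
  rewrite -dvdp_rat_int -(dvdp_map (ratr : rat -> algC)) !pZtoQtoC rsE.
  rewrite rmorphXn rmorphB rmorph1 /= map_polyXn.
  rewrite dvdpZl ?lead_coef_eq0 //.
  elim: rs rsN {rsE rsD} => [|x s IH] rsN; first by rewrite big_nil dvd1p.
  rewrite big_cons exprS; apply: dvdp_mul.
    rewrite dvdp_XsubCl /root !hornerE rsN ?subrr //.
    exact: mem_head.
  by apply: IH => y ys; apply: rsN; rewrite inE ys orbT.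
exists c; split=> // v; rewrite -(pactC tau) -pactM mul_polyC e pactM.
by rewrite kD pact0r.
Qed.

Let iter_inj n : injective (iter n tau).
Proof. by elim: n => // n IH v w /= /tau_inj /IH. Qed.

Let iter_pact n p v : iter n tau (pact tau p v) = pact tau p (iter n tau v).
Proof. by rewrite -!pactXn -!pactM mulrC. Qed.

Let span_coefs v : exists e : 'I_(size l) -> int, v = \sum_(i < size l) l`_i *~ e i.
Proof.
apply: (@span_l (fun v => exists e : 'I_(size l) -> int, v = \sum_(i < size l) l`_i *~ e i)).
- by exists (fun=> 0); rewrite big1.
- move=> _ _ [e ->] [f ->]; exists (fun i => e i - f i).
  by rewrite -sumrB; apply: eq_bigr => i _; rewrite mulrzBr.
- move=> w /(nthP 0)[i il <-]; exists (fun j => (j == Ordinal il)%:Z).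
  rewrite (bigD1 (Ordinal il)) //= eqxx mulr1z big1 ?addr0 // => j /negPf->.
  by rewrite mulr0z.
Qed.

(** The image of V under p(tau) is finitely generated and killed by c, hence
    finite: a vector of it is determined by its coordinates modulo c. *)
Let torsion_periodic p (c : int) v : c != 0 -> (forall w, pact tau p w *~ c = 0) ->
  exists2 n, (0 < n)%N & iter n tau (pact tau p v) = pact tau p v.
Proof.
move=> c0 pc; have /choice[e eE] := fun j => span_coefs (iter j tau v).
pose f j : {ffun 'I_(size l) -> 'I_(`|c|%N).+1} := [ffun i => inord (absz (e j i %% c)%Z)].
have [j [k [jk fjk]]] := nat_pigeonhole f.
exists (k - j)%N; first by rewrite subn_gt0.
apply: (@iter_inj j); rewrite -iterD subnKC ?(ltnW jk) // !iter_pact !eE.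
have pact_sum (g : 'I_(size l) -> int) :
    pact tau p (\sum_(i < size l) l`_i *~ g i) = \sum_(i < size l) pact tau p l`_i *~ (g i %% c)%Z.
  have pactMz m w : pact tau p (w *~ m) = pact tau p w *~ m.
    by rewrite -!(pactC tau) -!pactM mulrC.
  rewrite (big_morph (pact tau p) (pactDr tau p) (pact0r tau p)).
  apply: eq_bigr => i _; rewrite pactMz {1}(divz_eq (g i) c) mulrzDr.
  by rewrite mulrC mulrzA pc mul0rz add0r.
rewrite !pact_sum; apply: eq_bigr => i _; congr (_ *~ _).
have /ffunP/(_ i)/(congr1 val) := fjk; rewrite !ffunE /= => E.
have := modz_ge0 (e j i) c0; have := modz_ge0 (e k i) c0.
have := ltz_mod (e j i) c0; have := ltz_mod (e k i) c0 => *.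
by move: E; rewrite !inordK; lia.
Qed.

(** The image of (tau ^ N - 1) ^ m is finite, so a power of tau fixes it
    pointwise; one more factor kills it. *)
Lemma quasi_unipotent : exists N m,
  (0 < N)%N /\ forall v, pact tau (('X^N - 1) ^+ m) v = 0.
Proof.
have [N [m [c [N0 c0 tors]]]] := annihilator_torsion.
have per_mul n k w : iter n tau w = w -> iter (k * n) tau w = w.
  by move=> nw; elim: k => // k IH; rewrite mulSn iterD IH.
have [M M0 perM] : exists2 M, (0 < M)%N & forall v, v \in l ->
    iter M tau (pact tau (('X^N - 1) ^+ m) v) = pact tau (('X^N - 1) ^+ m) v.
  elim: (l) => [|a s [M M0 sM]]; first by exists 1%N.
  have [n n0 na] := torsion_periodic a c0 tors.
  exists (M * n)%N; first by rewrite muln_gt0 M0.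
  move=> v; rewrite inE => /predU1P[->|vs]; first exact: per_mul.
  by rewrite mulnC; apply: per_mul; apply: sM.
exists (N * M)%N, m.+1; split; first by rewrite muln_gt0 N0.
have [s sE] : exists s : {poly int}, 'X^(N * M) - 1 = s * ('X^N - 1).
  by exists (\sum_(i < M) 'X^N ^+ i); rewrite mulrC -subrX1 exprM.
apply: kills_gens => v vl; rewrite exprS {2}sE exprMn mulrCA pactM pactM.
rewrite pactD pactXn pactN pact1.
have -> : iter (N * M) tau (pact tau (('X^N - 1) ^+ m) v) = pact tau (('X^N - 1) ^+ m) v.
  by apply: per_mul; apply: perM.
by rewrite subrr pact0r.
Qed.

End QuasiUnipotent.

(** * Abelian quotients *)

Section AbelianQuotient.
Variable G : groupType.
Implicit Types (N H : set G) (x y z : G).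
Local Open Scope ring_scope.

(** The group H / N in additive notation, for N containing the commutators of H.
    The map pi carries information on H only.  The elements of A are canonical
    representatives of cosets. *)
Lemma abelian_quotient N H : subgroup N -> subgroup H -> N `<=` H ->
  (forall x y, H x -> H y -> N [~ x, y]%g) ->
  exists (A : zmodType) (pi : G -> A),
    [/\ forall x y, H x -> H y -> pi (x * y)%g = pi x + pi y,
        forall x, H x -> (pi x = 0 <-> N x)
      & forall a, exists2 x, H x & pi x = a].
Proof.
move=> sN sH NH cHN.
pose r x : G := choose (fun y => `[< N (x^-1 * y)%g >]) x.
have xx x : `[< N (x^-1 * x)%g >] by apply/asboolP; rewrite mulVg; apply: subgroup1.
have rP x : N (x^-1 * r x)%g.
  by apply/asboolP; exact: (@chooseP _ (fun y => `[< N (x^-1 * y)%g >]) x (xx x)).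
have rE x y : N (x^-1 * y)%g -> r x = r y.
  move=> Nxy; rewrite /r.
  have PE : (fun z => `[< N (x^-1 * z)%g >]) =1 (fun z => `[< N (y^-1 * z)%g >]).
    move=> z; apply/asboolP/asboolP => Nz.
      have -> : (y^-1 * z = (x^-1 * y)^-1 * (x^-1 * z))%g.
        by rewrite invgM invgK -!mulgA mulVKg.
      by apply: subgroupM => //; apply: subgroupV.
    have -> : (x^-1 * z = (x^-1 * y) * (y^-1 * z))%g by rewrite -!mulgA mulVKg.
    exact: subgroupM.
  rewrite (eq_choose PE); apply: choose_id; last exact: xx.
  by have /= <- := PE x; exact: xx.
have rH x : H x -> H (r x).
  by move=> Hx; exact: subgroupMl sH (subgroupV sH Hx) (NH _ (rP x)).
have rr x : r (r x) = r x by rewrite -(rE x (r x)).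
pose T := {x : G | `[< H x >] && (r x == x)}.
have inT x : H x -> `[< H (r x) >] && (r (r x) == r x).
  by move=> Hx; rewrite rr eqxx andbT; apply/asboolP/rH.
have TH (u : T) : H (val u) by have /andP[/asboolP] := valP u.
have Tr (u : T) : r (val u) = val u by have /andP[_ /eqP] := valP u.
pose mk x (Hx : H x) : T := exist _ (r x) (inT x Hx).
have mkP (u : T) : exists x Hx, u = mk x Hx.
  by exists (val u), (TH u); apply: val_inj; rewrite /= Tr.
have mkE x y Hx Hy : N (x^-1 * y)%g -> mk x Hx = mk y Hy.
  by move=> Nxy; apply/val_inj/rE.
pose add (u v : T) : T := mk _ (subgroupM sH (TH u) (TH v)).
pose opp (u : T) : T := mk _ (subgroupV sH (TH u)).
pose zero : T := mk _ (subgroup1 sH).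
have nN x y : N x -> H y -> N (x ^ y)%g.
  move=> Nx Hy; have -> : (x ^ y = x * [~ x, y])%g by rewrite commgEl mulVKg.
  by apply: subgroupM => //; apply: cHN => //; apply: NH.
have addE x y Hx Hy Hxy : add (mk x Hx) (mk y Hy) = mk (x * y)%g Hxy.
  apply/esym/mkE => /=.
  have -> : ((x * y)^-1 * (r x * r y) = (x^-1 * r x) ^ y * (y^-1 * r y))%g.
    by rewrite invgM conjgE !mulgA mulgK.
  by apply: subgroupM => //; apply: nN.
have oppE x Hx HVx : opp (mk x Hx) = mk (x^-1)%g HVx.
  apply/esym/mkE => /=; rewrite invgK.
  have -> : (x * (r x)^-1 = ((x^-1 * r x)^-1) ^ x^-1)%g.
    by rewrite invgM invgK conjgE invgK !mulgA mulgK.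
  by apply: nN; apply: subgroupV.
have addA : associative add.
  move=> u v w; have [x [Hx ->]] := mkP u; have [y [Hy ->]] := mkP v.
  have [z [Hz ->]] := mkP w.
  have [Hxy Hyz] := (subgroupM sH Hx Hy, subgroupM sH Hy Hz).
  have Hxyz : H (x * (y * z))%g by apply: subgroupM.
  have Hxyz' : H (x * y * z)%g by apply: subgroupM.
  rewrite (addE _ _ _ _ Hyz) (addE _ _ _ _ Hxyz) (addE _ _ _ _ Hxy) (addE _ _ _ _ Hxyz').
  by apply: mkE; rewrite -(mulgA x) mulVg; apply: subgroup1.
have addC : commutative add.
  move=> u v; have [x [Hx ->]] := mkP u; have [y [Hy ->]] := mkP v.
  have [Hxy Hyx] := (subgroupM sH Hx Hy, subgroupM sH Hy Hx).
  rewrite (addE _ _ _ _ Hxy) (addE _ _ _ _ Hyx); apply: mkE.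
  have -> : ((x * y)^-1 * (y * x) = [~ y, x])%g.
    by rewrite invgM commgEl conjgE -!mulgA.
  exact: cHN.
have add0 : left_id zero add.
  move=> u; have [x [Hx ->]] := mkP u; have H1x : H (1 * x)%g by rewrite mul1g.
  by rewrite (addE _ _ _ _ H1x); apply: mkE; rewrite mul1g mulVg; apply: subgroup1.
have addN : left_inverse zero opp add.
  move=> u; have [x [Hx ->]] := mkP u; have HVx := subgroupV sH Hx.
  have HVxx := subgroupM sH HVx Hx; rewrite (oppE _ _ HVx) (addE _ _ _ _ HVxx).
  by apply: mkE; rewrite mulVg mulg1 invg1; apply: subgroup1.
pose A : zmodType := HB.pack_for zmodType T (GRing.isZmodule.Build T addA addC add0 addN).
pose pi x : A := if pselect (H x) is left Hx then mk x Hx else zero.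
have piE x Hx : pi x = mk x Hx.
  by rewrite /pi; case: pselect => // Hx'; apply: mkE; rewrite mulVg; apply: subgroup1.
exists A, pi; split.
- move=> x y Hx Hy; rewrite (piE _ Hx) (piE _ Hy) (piE _ (subgroupM sH Hx Hy)).
  exact/esym/addE.
- move=> x Hx; rewrite (piE _ Hx); split=> [e|Nx]; last first.
    by apply: mkE; rewrite mulg1; apply: subgroupV.
  have rx1 : r x = r 1%g := congr1 val e.
  have N1 : N (r 1%g) by have := rP 1%g; rewrite invg1 mul1g.
  rewrite -[x]invgK; apply: subgroupV => //; apply: (subgroupMr sN N1).
  by rewrite -rx1.
- by move=> a; have [x [Hx ->]] := mkP a; exists x => //; apply: piE.
Qed.

End AbelianQuotient.

(** * Relative central series *)

Section DescendingSeries.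
Variable G : groupType.
Implicit Types (F H K M N : set G) (s t x y z : G) (S : seq G).
Local Open Scope group_scope.

Fixpoint descending M K n : set G :=
  if n is m.+1 then generated [set [~ x, y] | x in descending M K m & y in K]
  else M.

Lemma lower_central_descending K n : lower_central K n = descending K K n.
Proof. by elim: n => //= n ->. Qed.

Lemma subgroup_descending M K n : subgroup M -> subgroup (descending M K n).
Proof. by case: n => // n _; apply: subgroup_gen. Qed.

Lemma descendingR M K n x y : descending M K n x -> K y -> descending M K n.+1 [~ x, y].
Proof. by move=> Dx Ky; apply: sub_gen; exists x => //; exists y. Qed.

Lemma descendingS M M' K K' n : M `<=` M' -> K `<=` K' ->
  descending M K n `<=` descending M' K' n.
Proof.
move=> MM' KK'; elim: n => //= n IH; apply: genS => _ [x /IH Dx [y Ky <-]].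
by exists x => //; exists y => //; apply: KK'.
Qed.

Lemma descending_add M K m n :
  descending M K (m + n) = descending (descending M K m) K n.
Proof. by elim: n => [|n IH]; rewrite ?addn0 // addnS /= IH. Qed.

Lemma normalizes_descending M K n t :
  normalizes M t -> normalizes K t -> normalizes (descending M K n) t.
Proof.
move=> nM nK; elim: n => //= n IH.
apply: normalizes_gen => _ [x Dx [y Ky <-]]; rewrite conjRg; apply: sub_gen.
  by exists (x ^ t); [apply/IH|exists (y ^ t); [apply/nK|]].
by exists (x ^ t^-1); [apply/(normalizesV IH)|exists (y ^ t^-1); [apply/(normalizesV nK)|]].
Qed.

Lemma descending_sub M K n : subgroup M ->
  (forall y, K y -> normalizes M y) -> subgroup K ->
  descending M K n.+1 `<=` descending M K n.
Proof.
move=> sM nM sK; apply: gen_sub; first exact: subgroup_descending.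
move=> _ [x Dx [y Ky <-]]; rewrite commgEl.
have sD : subgroup (descending M K n) by apply: subgroup_descending.
apply: subgroupM => //; first exact: subgroupV.
by apply/normalizes_descending => //; [apply: nM|apply: normalizes_sub].
Qed.

Lemma comm_mul x y z : [~ x, y * z] = [~ x, z] * [~ x, y] ^ z.
Proof.
by rewrite !commgEl conjgM (conjMg x^-1) conjVg -mulgA mulVKg.
Qed.

Lemma comm_inv x y : [~ x, y^-1] = [~ x ^ y^-1, y]^-1.
Proof. by rewrite !commgEl -conjgM mulVg conjg1 invgM invgK. Qed.

(** The elements y with [F, y] contained in F' form a subgroup, by [comm_mul] and
    [comm_inv], so it is enough to consider M and s. *)
Lemma comm_adjoin F F' M s : subgroup F' ->
  (forall y, adjoin M s y -> normalizes F y) ->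
  (forall y, adjoin M s y -> normalizes F' y) -> subgroup M ->
  (forall x y, F x -> M y -> F' [~ x, y]) -> (forall x, F x -> F' [~ x, s]) ->
  forall x y, F x -> adjoin M s y -> F' [~ x, y].
Proof.
move=> sF' nF nF' sM FM Fs x y Fx [a [b [z [Mz ->]]]].
have Ks : adjoin M s s by apply: adjoin_base.
have FV u v : adjoin M s u -> (forall w, F w -> F' [~ w, u]) -> F v -> F' [~ v, u^-1].
  move=> Ku Fu Fv; rewrite comm_inv; apply: subgroupV => //; apply: Fu.
  by apply/(normalizesV (nF _ Ku)).
have FX n w : F w -> F' [~ w, s ^+ n].
  elim: n w => [|n IH] w Fw; first by rewrite expg0 commg1; apply: subgroup1.
  rewrite expgS comm_mul; apply: subgroupM => //; first exact: IH.
  by apply/normalizesX; [apply: nF'|apply: Fs].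
have Kp m n : adjoin M s (s ^- m * s ^+ n) by apply: adjoin_powers.
have KX n : adjoin M s (s ^+ n) by have := Kp 0%N n; rewrite invg1 mul1g.
rewrite comm_mul; apply: subgroupM => //; first exact: FM.
apply/nF'; first exact: sub_adjoin.
rewrite comm_mul; apply: subgroupM => //; first exact: FX.
apply/nF' => //; apply: FV => // w; exact: FX.
Qed.

(** The commutators of M <s> lie in M, after which the series of M takes over. *)
Lemma nilpotent_adjoin M s n : subgroup M -> normalizes M s ->
  descending M (adjoin M s) n `<=` [set 1] -> nilpotent (adjoin M s).
Proof.
move=> sM nM Dn; exists n.+1; apply/seteqP; split; last first.
  move=> _ ->; rewrite lower_central_descending; apply: subgroup1.
  by apply: subgroup_descending; apply: subgroup_adjoin.
apply: subset_trans Dn; rewrite lower_central_descending -add1n descending_add.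
apply: descendingS => // z; apply: gen_sub => // _ [x Kx [y Ky <-]].
have nK w : adjoin M s w -> normalizes M w.
  by apply: normalizes_adjoin => // v Mv; apply: normalizes_sub.
apply: (@comm_adjoin (adjoin M s) M M s) => //.
- by move=> w Kw; apply: normalizes_sub => //; apply: subgroup_adjoin.
- move=> u v Ku Mv; rewrite commgEr; apply: subgroupM => //.
  by apply/nK => //; apply: subgroupV.
- move=> _ [a [b [v [Mv ->]]]].
  have -> : [~ s ^- a * s ^+ b * v, s] = v^-1 * v ^ s.
    rewrite commgEl conjMg.
    have -> : (s ^- a * s ^+ b) ^ s = s ^- a * s ^+ b.
      apply/conjg_fixP/commgP/commute_sym.
      by apply: commuteM; [apply: commuteV|]; apply: commuteX; apply: commute_refl.
    by rewrite (invgM _ v) -(mulgA v^-1) mulKg.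
  by apply: subgroupM => //; [apply: subgroupV|apply/nM].
Qed.

End DescendingSeries.

(** * Conjugation on an abelian section *)

Section Unipotent.
Variable G : groupType.
Implicit Types (F H K M N : set G) (s t x y z : G) (S : seq G).
Local Open Scope group_scope.
Hypothesis nf : no_free_semigroup G.

(** In additive notation, [conjword x t u] is the value at x of this polynomial in
    conjugation by t. *)
Fixpoint wordpoly (u : seq bool) : {poly int} :=
  if u is c :: v then (c%:R *: 'X^(size v) + wordpoly v)%R else 0%R.

Lemma coef_wordpoly u i : ((wordpoly u)`_i = (nth false (rev u) i)%:R)%R.
Proof.
elim: u => [|c u IH] /=; first by rewrite coef0 nth_nil.
rewrite coefD coefZ coefXn IH rev_cons nth_rcons size_rev.
have [iu|ui|->] := ltngtP i (size u); rewrite ?mulr0 ?add0r //.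
  by rewrite nth_default ?size_rev ?(ltnW ui).
by rewrite mulr1 nth_default ?size_rev // addr0.
Qed.

Lemma wordpoly_inj u v : size u = size v -> wordpoly u = wordpoly v -> u = v.
Proof.
move=> uv /polyP e; rewrite -[u]revK -[v]revK; congr rev.
apply: (@eq_from_nth _ false); rewrite ?size_rev // => i _.
by have := e i; rewrite !coef_wordpoly; do 2!case: nth.
Qed.

(** Conjugation by t induces an automorphism tau of A = H / N, and relations
    between conjugates become polynomial relations for the powers of tau. *)
Lemma quasi_unipotent_section N H t : subgroup N -> fg H -> N `<=` H ->
  (forall x y, H x -> H y -> N [~ x, y]) -> normalizes H t -> normalizes N t ->
  exists (A : zmodType) (pi : G -> A) (tau : {additive A -> A}) n m,
    [/\ [/\ forall x y, H x -> H y -> pi (x * y) = (pi x + pi y)%R,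
            forall x, H x -> (pi x = 0%R <-> N x)
          & forall a, exists2 x, H x & pi x = a],
        forall x, H x -> pi (x ^ t) = tau (pi x),
        (0 < n)%N
      & forall v, pact tau (('X^n - 1) ^+ m)%R v = 0%R].
Proof.
move=> sN fH NH cHN nH nN; have sH := fg_subgroup fH.
have [A [pi [piM pi0 pi_surj]]] := abelian_quotient sN sH NH cHN.
have /boolp.choice[sec secP] : forall a, exists x, H x /\ pi x = a.
  by move=> a; have [x Hx <-] := pi_surj a; exists x.
have {secP} [secH secK] : (forall a, H (sec a)) /\ cancel sec pi.
  by split=> a; case: (secP a).
have pi1 : pi 1 = 0%R by apply/pi0; apply: subgroup1.
have piV x : H x -> pi x^-1 = (- pi x)%R.
  move=> Hx; apply/eqP; rewrite -addr_eq0 -piM ?mulVg ?pi1 //.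
  exact: subgroupV.
have pi_eq x y : H x -> H y -> (pi x = pi y <-> N (x^-1 * y)).
  move=> Hx Hy; have Vx := subgroupV sH Hx; rewrite -pi0 ?piM ?piV //; last exact: subgroupM.
  by split=> [->|/eqP]; rewrite ?addNr // addrC subr_eq0 => /eqP->.
have Ht x : H x -> H (x ^ t) by move/nH.
have pit x y : H x -> H y -> pi x = pi y -> pi (x ^ t) = pi (y ^ t).
  move=> Hx Hy /pi_eq Nxy; apply/pi_eq; try exact: Ht.
  by rewrite -conjVg -conjMg; apply/nN; apply: Nxy.
pose tau0 a := pi (sec a ^ t).
have tau0P x : H x -> pi (x ^ t) = tau0 (pi x).
  by move=> Hx; apply: pit => //; rewrite secK.
have tau0B : zmod_morphism tau0.
  move=> a b; have Vb := subgroupV sH (secH b).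
  rewrite -[in LHS](secK a) -[in LHS](secK b) -piV // -piM // -tau0P; last exact: subgroupM.
  have [Hat Hbt] := (Ht _ (secH a), Ht _ (secH b)); have Vbt := subgroupV sH Hbt.
  by rewrite conjMg conjVg piM ?piV.
pose tau : {additive A -> A} := HB.pack tau0 (GRing.isZmodMorphism.Build A A tau0 tau0B).
have tauP x : H x -> pi (x ^ t) = tau (pi x) by exact: tau0P.
have piX k x : H x -> pi (x ^ (t ^+ k)) = iter k tau (pi x).
  move=> Hx; elim: k => [|k IH]; first by rewrite expg0 conjg1.
  by rewrite expgSr conjgM tauP ?IH //; apply/normalizesX.
have pi_word k x u : H x ->
    pi (conjword x (t ^+ k) u) = pact tau (wordpoly u \Po 'X^k)%R (pi x).
  move=> Hx; have Hw v : H (conjword x (t ^+ k) v).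
    elim: v => [|c v IH] /=; first exact: subgroup1.
    apply: subgroupM => //; apply: subgroupX => //; apply/normalizesX => //.
    exact: normalizesX.
  elim: u => [|c u IH] /=; first by rewrite comp_poly0 pact0.
  rewrite comp_polyD pactD comp_polyZ comp_Xn_poly -exprM -mul_polyC pactM.
  rewrite pactXn pactC piM //; last first.
    by apply: subgroupX => //; apply/normalizesX => //; apply: normalizesX.
  rewrite IH -expgnA; congr (_ + _)%R.
  by case: c; rewrite ?expg0 ?expg1 ?pi1 ?mulr0z ?mulr1z // piX.
have tau_inj : injective tau.
  move=> a b; rewrite -[a]secK -[b]secK -!tauP // => /pi_eq Nab.
  apply/pi_eq => //; apply/(nN _); rewrite conjMg conjVg; apply: Nab; exact: Ht.
have [S HE] := fH.
have span (P : A -> Prop) : P 0%R -> (forall v w, P v -> P w -> P (v - w)%R) ->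
    (forall v, v \in [seq pi x | x <- S] -> P v) -> forall v, P v.
  move=> P0 PB PS v; rewrite -[v]secK.
  have PN a : P a -> P (- a)%R by move=> Pa; rewrite -sub0r; apply: PB.
  have PD a b : P a -> P b -> P (a + b)%R.
    by move=> Pa Pb; rewrite -[b]opprK; apply: PB => //; apply: PN.
  suff : generated [set` S] `<=` [set x | H x /\ P (pi x)].
    by rewrite -HE => /(_ _ (secH v))[].
  apply: gen_sub; last first.
    move=> x xS; split; first by rewrite HE; apply: sub_gen.
    by apply: PS; apply: map_f.
  apply/subgroupP; split=> [|x y [Hx Px] [Hy Py]|x [Hx Px]].
  - by split; [apply: subgroup1|rewrite pi1].
  - by split; [apply: subgroupM|rewrite piM //; apply: PD].
  - by split; [apply: subgroupV|rewrite piV //; apply: PN].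
have relations k v : (0 < k)%N -> exists F : {poly int},
    [/\ F != 0, forall i, `|F`_i| <= 1 & pact tau (F \Po 'X^k) v = 0]%R.
  move=> _; have [u [w [uw nuw e]]] := conjword_relation (sec v) (t ^+ k) nf.
  exists (wordpoly u - wordpoly w)%R; split.
  - by rewrite subr_eq0; apply/eqP => /(wordpoly_inj uw).
  - by move=> i; rewrite coefB !coef_wordpoly; do 2!case: nth.
  - rewrite comp_polyB pactD pactN -[v]secK -!pi_word // e subrr //.
have [n [m [n0 uni]]] := quasi_unipotent tau_inj span relations.
exists A, pi, tau, n, m; by split=> //.
Qed.

End Unipotent.

(** * A power acting unipotently *)

Section UnipotentPower.
Variable G : groupType.
Implicit Types (F H K M N : set G) (s t x y z : G) (S : seq G).
Local Open Scope group_scope.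
Hypothesis nf : no_free_semigroup G.

(** Let s = t ^+ (n * l).  M acts trivially on H / N, and s unipotently, so each
    commutator with M <s> carries E i.+1 into E i, where E i is the preimage in H
    of the kernel of (s - 1) ^ i on H / N.  Multiples of n are allowed so that
    the powers needed for several layers can be combined. *)
Lemma descending_layer M N H t : subgroup M -> subgroup N -> fg H -> N `<=` H ->
  H `<=` M -> (forall x y, H x -> M y -> N [~ x, y]) ->
  normalizes H t -> normalizes N t ->
  exists2 n, (0 < n)%N & forall l k,
    descending M (adjoin M (t ^+ (n * l))) k `<=` H ->
    exists k', descending M (adjoin M (t ^+ (n * l))) k' `<=` N.
Proof.
move=> sM sN fH NH HM cHMN tH tN; have sH := fg_subgroup fH.
have cHN x y : H x -> H y -> N [~ x, y] by move=> Hx /HM; apply: cHMN.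
have [A [pi [tau [n [m [[piM pi0 pi_surj] pit n0 uni]]]]]] :=
  quasi_unipotent_section nf sN fH NH cHN tH tN.
exists n => // l k DH; set s := t ^+ (n * l) in DH *.
pose Q : {poly int} := ('X^(n * l) - 1)%R.
have [R QE] : exists R : {poly int}, Q = (R * ('X^n - 1))%R.
  by exists (\sum_(i < l) 'X^n ^+ i)%R; rewrite /Q mulrC -subrX1 exprM.
have piX i x : H x -> pi (x ^ (t ^+ i)) = iter i tau (pi x).
  move=> Hx; elim: i => [|i IH]; first by rewrite expg0 conjg1.
  by rewrite expgSr conjgM pit ?IH //; apply/normalizesX.
have sK y : H y -> H y^-1 by apply: subgroupV.
have piV x : H x -> pi x^-1 = (- pi x)%R.
  move=> Hx; apply/eqP; rewrite -addr_eq0 -piM ?mulVg //; last exact: sK.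
  by apply/eqP/pi0; apply: subgroup1.
have HMJ x y : H x -> M y -> H (x ^ y) /\ pi (x ^ y) = pi x.
  move=> Hx My; have Nxy := cHMN _ _ Hx My; have Hxy := NH _ Nxy.
  have -> : x ^ y = x * [~ x, y] by rewrite commgEl mulVKg.
  split; first exact: subgroupM.
  by rewrite piM // (proj2 (pi0 _ Hxy) Nxy) addr0.
have tau0 i b : iter i tau b = 0%R -> b = 0%R.
  elim: i => // i IH /=; have [x Hx xE] := pi_surj (iter i tau b).
  have Hxt : H (x ^ t) by apply/tH.
  rewrite -xE -pit // => /(pi0 _ Hxt)/tN Nx; apply: IH; rewrite -xE.
  exact/pi0.
pose E i : set G := [set x | H x /\ pact tau (Q ^+ i)%R (pi x) = 0%R].
have sE i : subgroup (E i).
  apply/subgroupP; split=> [|x y [Hx xi] [Hy yi]|x [Hx xi]].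
  - split; first exact: subgroup1.
    have /pi0 -> : N 1 := subgroup1 sN; [exact: pact0r|exact: subgroup1].
  - by split; [apply: subgroupM|rewrite piM // pactDr xi yi addr0].
  - split; first exact: sK.
    apply: (addrI (pact tau (Q ^+ i)%R (pi x))).
    by rewrite -pactDr piV // subrr pact0r addr0.
have nHs : normalizes H s by apply: normalizesX.
have pact_s i x : H x ->
    pact tau (Q ^+ i)%R (pi (x ^ s)) = iter (n * l) tau (pact tau (Q ^+ i)%R (pi x)).
  by move=> Hx; rewrite piX // -!pactXn -!pactM mulrC.
have nE i y : adjoin M s y -> normalizes (E i) y.
  apply: normalizes_adjoin.
    move=> x; split=> [[Hxs xi]|[Hx xi]]; last first.
      by split; [apply/nHs|rewrite pact_s // xi; elim: (n * l)%N => //= k' ->; rewrite raddf0].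
    have Hx : H x by apply/nHs.
    by split=> //; move: xi; rewrite pact_s // => /tau0.
  move=> z Mz; apply: normalizesP => x [Hx xi].
    by have [Hxz pixz] := HMJ x z Hx Mz; split=> //; rewrite pixz.
  have [Hxz pixz] := HMJ x z^-1 Hx (subgroupV sM Mz).
  by split=> //; rewrite pixz.
have key j i : (i + j)%N = m -> descending M (adjoin M s) (k + j) `<=` E i.
  elim: j i => [|j IH] i.
    rewrite !addn0 => -> x Dx; split; first exact: DH.
    by rewrite QE exprMn pactM uni pact0r.
  rewrite addnS -addSn => /IH Ei; rewrite addnS; apply: gen_sub => //.
  move=> _ [x /Ei Ex [y Ky <-]]; apply: (comm_adjoin (sE i) (nE i.+1) (nE i) sM _ _ Ex Ky).
    move=> u v [Hu _] Mv; have Nuv := cHMN _ _ Hu Mv; have Huv := NH _ Nuv.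
    by split=> //; rewrite (proj2 (pi0 _ Huv) Nuv) pact0r.
  move=> u [Hu ui]; have Hus : H (u ^ s) by apply/nHs.
  split; first by rewrite commgEl; apply: subgroupM => //; apply: sK.
  rewrite -ui exprSr pactM commgEl piM ?piV //; last exact: sK.
  by congr (pact tau _ _); rewrite piX // -pactXn pactD pactN pact1 addrC.
exists (k + m)%N => x /(key m 0%N (add0n m))[Hx]; rewrite expr0 pact1.
by move/pi0; apply.
Qed.

(** Induction on the layers of the lower central series of M. *)
Lemma descending_lower_central M t i : subgroup M -> normalizes M t ->
  (forall j, fg (lower_central M j)) ->
  exists2 n, (0 < n)%N & forall l, exists k,
    descending M (adjoin M (t ^+ (n * l))) k `<=` lower_central M i.
Proof.
move=> sM nM fM; elim: i => [|i [n n0 IH]].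
  by exists 1%N => // l; exists 0%N.
have nL j : normalizes (lower_central M j) t.
  by rewrite lower_central_descending; apply: normalizes_descending.
have cM x y : lower_central M i x -> M y -> lower_central M i.+1 [~ x, y].
  by rewrite !lower_central_descending; apply: descendingR.
have nMM y : M y -> normalizes M y by apply: normalizes_sub.
have LS j : lower_central M j.+1 `<=` lower_central M j.
  by rewrite !lower_central_descending; apply: descending_sub.
have LM j : lower_central M j `<=` M.
  by elim: j => // j IHj; apply: subset_trans (LS j) IHj.
have [n' n'0 step] := descending_layer sM (fg_subgroup (fM i.+1)) (fM i) (@LS i)
  (@LM i) cM (nL i) (nL i.+1).
exists (n * n')%N; first by rewrite muln_gt0 n0.
move=> l; have [k kL] := IH (n' * l)%N; have := step (n * l)%N k.
by rewrite mulnCA -mulnA; apply.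
Qed.

End UnipotentPower.

(** * Growth of unipotent extensions *)

Section GrowthOfExtension.
Variable G : groupType.
Implicit Types (F H K M N : set G) (s t u x y z : G) (S : seq G).
Local Open Scope group_scope.

(** If u acts unipotently then x ^ (u ^+ k) has polynomial length in k:
    x ^ (u ^+ k.+1) is x ^ (u ^+ k) times [~ x, u] ^ (u ^+ k), and [~ x, u] lies
    one step deeper in the series. *)
Lemma conj_length_polynomial M K S u j :
  (forall n, descending M K n `<=` generated [set` S]) -> K u ->
  forall n x, descending M K (n + j) `<=` [set 1] -> descending M K n x ->
  exists C, forall k, ball [set` S] (C * k.+1 ^ j) (x ^ (u ^+ k)).
Proof.
move=> DS Ku; elim: j => [|j IH] n x D1 Dx.
  exists 0%N => k; move: D1; rewrite addn0 => /(_ _ Dx) ->.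
  by rewrite conj1g; apply: ball1.
have [||C CP] := IH n.+1 [~ x, u]; first by rewrite addSnnS.
  exact: descendingR.
have [B xB] := gen_ball (DS _ _ Dx).
exists (B + C)%N; elim=> [|k IHk].
  by rewrite expg0 conjg1 exp1n muln1; apply: ball_le xB; apply: leq_addr.
have -> : x ^ (u ^+ k.+1) = x ^ (u ^+ k) * [~ x, u] ^ (u ^+ k).
  by rewrite -conjMg commgEl mulVKg -conjgM expgS.
apply: ball_le (ball_mul IHk (CP k)).
have -> : ((B + C) * k.+1 ^ j.+1 + C * k.+1 ^ j = ((B + C) * k.+1 + C) * k.+1 ^ j)%N.
  by rewrite expnS; nia.
rewrite expnS mulnA leq_mul //; first by nia.
by case: (j) => // i; rewrite leq_exp2r.
Qed.

(** One constant for all generators and for both directions. *)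
Lemma conj_lengths_polynomial M s S n : subgroup M -> M = generated [set` S] ->
  normalizes M s -> descending M (adjoin M s) n `<=` [set 1] ->
  exists C, forall a b x, ball [set` S] 1 x ->
    ball [set` S] (C * (a + b).+1 ^ n) (x ^ (s ^- a * s ^+ b)).
Proof.
move=> sM ME nM D1; have sK := subgroup_adjoin sM nM.
have nK y : adjoin M s y -> normalizes M y.
  by apply: normalizes_adjoin => // z; apply: normalizes_sub.
have DM m : descending M (adjoin M s) m `<=` generated [set` S].
  rewrite -ME; elim: m => // m IH.
  by apply: subset_trans IH; apply: descending_sub.
have Ks : adjoin M s s by apply: adjoin_base.
have [C CP] : exists C, forall k u x, u = s \/ u = s^-1 -> x \in S ->
    ball [set` S] (C * k.+1 ^ n) (x ^ (u ^+ k)).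
  have SM : [set` S] `<=` M by rewrite ME; apply: sub_gen.
  elim: {1 2}S SM => [|y T IH] TM; first by exists 0%N.
  have [|C CP] := IH; first by move=> x xT; apply: TM; rewrite /= inE xT orbT.
  have My : M y by apply: TM; rewrite /= mem_head.
  have [C1 C1P] := conj_length_polynomial DM Ks (n := 0) D1 My.
  have [C2 C2P] := conj_length_polynomial DM (subgroupV sK Ks) (n := 0) D1 My.
  exists (C + C1 + C2)%N => k u x us; rewrite inE => /predU1P[->|xT]; last first.
    by apply: ball_le (CP k u x us xT); rewrite leq_mul2r -addnA leq_addr orbT.
  case: us => ->.
    by apply: ball_le (C1P k); rewrite leq_mul2r addnAC leq_addl orbT.
  by apply: ball_le (C2P k); rewrite leq_mul2r leq_addl orbT.
have CP' k u x : u = s \/ u = s^-1 -> ball [set` S] 1 x ->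
    ball [set` S] (C * k.+1 ^ n) (x ^ (u ^+ k)).
  move=> us [_ -> [y yS <-]]; rewrite mul1g; case: yS => [->|yS|yS].
  - by rewrite conj1g; apply: ball1.
  - exact: CP.
  - by rewrite -[y]invgK conjVg; apply: ball_inv; apply: CP.
exists C => a b x xS; have [ab|ba] := leqP a b.
  rewrite -commuteXV -expgnFr //; apply: ball_le (CP' _ _ _ (or_introl erefl) xS).
  rewrite leq_mul2l; apply/orP; right.
  by case: (n) => // m; rewrite leq_exp2r //; lia.
have -> : s ^- a * s ^+ b = s^-1 ^+ (a - b).
  by rewrite expVgn expgnFr ?(ltnW ba) // invgF commuteXV.
apply: ball_le (CP' _ _ _ (or_intror erefl) xS).
rewrite leq_mul2l; apply/orP; right.
by case: (n) => // m; rewrite leq_exp2r //; lia.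
Qed.

(** Collecting the letters s to the left in a word of length m yields s ^- a s ^+ b
    with a, b <= m, followed by a product of at most m conjugates of generators
    of M by such powers of s, whose lengths in M are polynomial in m. *)
Lemma pgrowth_adjoin M s n : fg M -> normalizes M s -> pgrowth M ->
  descending M (adjoin M s) n `<=` [set 1] -> pgrowth (adjoin M s).
Proof.
move=> fM nM gM D1; have sM := fg_subgroup fM; have [S ME] := fM.
have sK := subgroup_adjoin sM nM.
have [C CP] := conj_lengths_polynomial sM ME nM D1.
have [|B [d BP]] := gM S; first by rewrite ME; apply: sub_gen.
pose S' := s :: S.
apply: (@poly_balls_gen _ [set` S']).
  have sg := subgroup_gen [set` S']; apply: adjoin_sub => //.
    by rewrite ME; apply: genS => x xS; rewrite /= inE xS orbT.
  by apply: sub_gen; rewrite /= mem_head.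
(* Stated for x^-1, because the form s ^- a s ^+ b y absorbs letters on its
   left. *)
have split_word (p : nat) m x : (m <= p)%N -> ball [set` S'] m x ->
    exists a b y, [/\ (a <= m)%N, (b <= m)%N,
      ball [set` S] (m * (C * (p + p).+1 ^ n)) y & x^-1 = s ^- a * s ^+ b * y].
  elim: m x => [|m IH] x mp.
    by move=> ->; exists 0%N, 0%N, 1; rewrite invg1 !mulg1.
  move=> [z mz [y yS' <-]]; have [a [b [w [am bm wS zE]]]] := IH z (ltnW mp) mz.
  have wS1 k : ball [set` S] (k + m * (C * (p + p).+1 ^ n)) w.
    by apply: ball_le wS; apply: leq_addl.
  rewrite invgM zE mulSn.
  have [yS|ys|ys] : [\/ ball [set` S] 1 y^-1, y = s | y = s^-1].
    case: yS' => [->|/=|/=]; first by constructor 1; rewrite invg1; apply: ball1.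
      rewrite inE => /predU1P[->|yS]; first by constructor 2.
      by constructor 1; apply: ball_letter; constructor 3; rewrite invgK.
    rewrite inE => /predU1P[ys|yS]; first by constructor 3; rewrite -ys invgK.
    by constructor 1; apply: ball_letter; constructor 2.
  - exists a, b, (y^-1 ^ (s ^- a * s ^+ b) * w); split; [exact: leqW|exact: leqW| |].
      apply: ball_mul => //; apply: ball_le (CP a b _ yS).
      rewrite leq_mul2l; apply/orP; right.
      by case: (n) => // k; rewrite leq_exp2r //; lia.
    by rewrite [RHS]mulgA -conjgC !mulgA.
  - exists a.+1, b, w; split=> //; [exact: leqW|].
    by rewrite ys expgSr invgM !mulgA.
  - exists a, b.+1, w; split=> //; [exact: leqW|].
    by rewrite ys invgK expgS !mulgA -(expg1 s) -commuteXV.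
pose q m := (m * (C * (m + m).+1 ^ n))%N.
exists (B * (C.+1 * 2 ^ n) ^ d)%N, (2 + n.+1 * d)%N => m.
have [l sl bl] := BP (q m).
exists [seq (w.1 * w.2)^-1 | w <- allpairs pair
   [seq s ^- a * s ^+ b | a <- iota 0 m.+1, b <- iota 0 m.+1] l].
  rewrite size_map !size_allpairs !size_iota.
  have qm : ((q m).+1 <= C.+1 * 2 ^ n * m.+1 ^ n.+1)%N.
    rewrite expnS mulnACA -expnMn /q.
    have : ((m + m).+1 ^ n <= (2 * m.+1) ^ n)%N.
      by case: (n) => // k; rewrite leq_exp2r //; lia.
    have : (0 < (2 * m.+1) ^ n)%N by rewrite expn_gt0 muln_gt0.
    by move: (_ ^ n)%N (_ ^ n)%N => u v; nia.
  have qmd : ((q m).+1 ^ d <= (C.+1 * 2 ^ n * m.+1 ^ n.+1) ^ d)%N.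
    by case: (d) => // e; rewrite leq_exp2r.
  rewrite expnD expnM [leqRHS]mulnCA -mulnn leq_mul2l; apply/orP; right.
  apply: leq_trans sl _; rewrite -mulnA leq_mul2l -expnMn qmd orbT //.
move=> x /(split_word m m x (leqnn m))[a [b [y [am bm yS xE]]]].
apply/mapP; exists (s ^- a * s ^+ b, y); last by rewrite /= -xE invgK.
apply: allpairs_f; last exact: bl.
by apply: (@allpairs_f _ _ _ (fun a b => s ^- a * s ^+ b)); rewrite mem_iota.
Qed.

End GrowthOfExtension.

(** * Extensions by cyclic and abelian groups *)

Section CyclicStep.
Variable G : groupType.
Implicit Types (F H K L M N : set G) (s t u x y z : G) (S : seq G).
Local Open Scope group_scope.

(** The conjugates of M0 by powers of t have the same index in M = <S>.  Such a
    subgroup is determined by the action of S on its cosets, once these are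
    labelled; so two of these conjugates coincide. *)
Lemma normalizing_power M0 M t : subgroup M0 -> M0 `<=` M -> finindex M0 M -> fg M ->
  normalizes M t -> exists2 k, (0 < k)%N & normalizes M0 (t ^+ k).
Proof.
move=> sM0 M0M [R RM] fM nM; have sM := fg_subgroup fM; have [S ME] := fM.
pose S' := 1 :: S ++ [seq s^-1 | s <- S].
pose lab j x : 'I_(size R).+1 :=
  inord (find (fun r => `[< M0 (r^-1 * x ^ (t ^- j)) >]) R).
have nMV j : normalizes M (t ^- j) by apply: normalizesV; apply: normalizesX.
have labP j x y : M x -> M y -> lab j x = lab j y <-> M0 ((x^-1 * y) ^ (t ^- j)).
  move=> Mx My; rewrite conjMg conjVg /lab; set x' := x ^ _; set y' := y ^ _.
  have [Mx' My'] : M x' /\ M y' by split; apply/nMV.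
  clearbody x' y'.
  split=> [/(congr1 val)|M0xy]; last first.
    congr inord; apply: eq_find => r; apply/asboolP/asboolP => M0r.
      by rewrite -(mulVKg x' y') mulgA; apply: subgroupM.
    have -> : r^-1 * x' = r^-1 * y' * (x'^-1 * y')^-1.
      by rewrite invgM invgK -!mulgA mulVKg.
    by apply: subgroupM => //; apply: subgroupV.
  rewrite /= !inordK ?ltnS ?find_size //.
  have nthR z : M z -> M0 ((R`_(find (fun r => `[< M0 (r^-1 * z) >]) R))^-1 * z).
    move=> Mz; apply/asboolP.
    apply: (@nth_find _ 1 (fun r => `[< M0 (r^-1 * z) >])).
    by have [r rR M0r] := RM z Mz; apply/hasP; exists r => //; apply/asboolP.
  have := nthR y' My'; have := nthR x' Mx'; move=> M0x M0y e.
  rewrite e in M0x; move: (subgroupM sM0 (subgroupV sM0 M0x) M0y).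
  by rewrite invgM invgK -mulgA mulVKg.
(* The action of S' on labels, as a set of triples, and the label of the subgroup
   itself. *)
pose code j : {ffun 'I_(size S') * 'I_(size R).+1 * 'I_(size R).+1 -> bool} *
    'I_(size R).+1 :=
  ([ffun w : 'I_(size S') * 'I_(size R).+1 * 'I_(size R).+1 =>
     `[< exists x, [/\ M x, lab j x = w.1.2
                             & lab j (S'`_(w.1.1) * x) = w.2] >]], lab j 1).
have [j [k [jk codejk]]] := nat_pigeonhole code.
have labjk x : M x -> lab j x = lab k x.
  rewrite {1}ME => /gen_ball[n]; rewrite -{2 3}[x]invgK => /ball_inv.
  elim: n (x^-1) => [_ ->|n IH _ [y ny [s sS <-]]].
    by rewrite invg1; have := congr1 snd codejk.
  have My : M y^-1 by apply: subgroupV => //; rewrite ME; apply: ball_sub ny => //;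
    [apply: subgroup_gen|apply: sub_gen].
  have sS' : s^-1 \in S'.
    rewrite inE mem_cat; case: sS => [->|sS|sS].
    - by rewrite invg1 eqxx.
    - by apply/or3P/Or33/map_f.
    - by apply/or3P/Or32.
  have Ms : M s^-1.
    case: sS => [->|sS|sS]; first by rewrite invg1; apply: subgroup1.
      by apply: subgroupV => //; rewrite ME; apply: sub_gen.
    by rewrite ME; apply: sub_gen.
  have iS : (index s^-1 S' < size S')%N by rewrite index_mem.
  have nS : S'`_(Ordinal iS) = s^-1 by rewrite /= nth_index.
  have /ffunP/(_ (Ordinal iS, lab j y^-1, lab j (s^-1 * y^-1))) := congr1 fst codejk.
  rewrite !ffunE /= nth_index // => /esym.
  rewrite [X in _ = X](_ : _ = true); last by apply/asboolP; exists y^-1.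
  move=> /asboolP[z [Mz zy szy]].
  rewrite invgM -szy; apply/labP; try exact: subgroupM.
  rewrite (IH _ ny) in zy; move/labP: zy => zy.
  by rewrite invgM invgK -mulgA mulVKg; apply: zy.
have eqM0 x : M x -> M0 (x ^ (t ^- j)) <-> M0 (x ^ (t ^- k)).
  move=> Mx; have M1 := subgroup1 sM.
  have := labP j 1 x M1 Mx; have := labP k 1 x M1 Mx; rewrite invg1 mul1g => <- <-.
  by rewrite !labjk.
exists (k - j)%N; first by rewrite subn_gt0.
suff nV : normalizes M0 (t ^- (k - j)).
  by rewrite -[_ ^+ _]invgK; apply: normalizesV.
have key x : M x -> M0 (x ^ (t ^- (k - j))) <-> M0 x.
  move=> Mx; have Mxj : M (x ^ (t ^+ j)) by apply/normalizesX.
  have := eqM0 _ Mxj; rewrite -!conjgM mulgV conjg1 => ->.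
  have -> : t ^+ j * t ^- k = t ^- (k - j).
    by rewrite -{1}(subnK (ltnW jk)) expgnDr invgM mulVKg.
  by [].
move=> x; split=> M0x; last by apply/key => //; apply: M0M.
by apply/key => //; apply/(nMV (k - j)%N); apply: M0M.
Qed.

(** The exponent b - a of t is divided by q with remainder; it is first shifted
    by the multiple a * q to become a natural number. *)
Lemma finindex_adjoin M0 M t q : subgroup M -> subgroup M0 -> (0 < q)%N ->
  normalizes M t -> normalizes M0 (t ^+ q) -> finindex M0 M ->
  finindex (adjoin M0 (t ^+ q)) (adjoin M t).
Proof.
move=> sM sM0 q0 nM nM0 [R RM]; set s := t ^+ q.
exists [seq t ^+ j * r | j <- iota 0 q, r <- R] => _ [a [b [m [Mm ->]]]].
pose e := (b + a * q.-1)%N; pose p := s ^- a * s ^+ (e %/ q)%N.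
have pE : t ^- a * t ^+ b = t ^+ (e %% q)%N * p.
  rewrite /p -!commuteXV mulgA /s -!expgnA -expgnDr (mulnC q (_ %/ _)) addnC -divn_eq.
  have -> : (q * a = a + a * q.-1)%N by rewrite -mulnS prednK // mulnC.
  by rewrite /e !expgnDr invgM !mulgA mulgK.
have nMp : normalizes M p by apply: normalizes_quotient; apply: normalizesX.
have [r rR M0r] : exists2 r, r \in R & M0 (r^-1 * m ^ p^-1).
  by apply: RM; apply/(normalizesV nMp).
exists (t ^+ (e %% q)%N * r); first by apply: allpairs_f => //; rewrite mem_iota ltn_pmod.
have sK := subgroup_adjoin sM0 nM0.
have Kp : adjoin M0 s p by apply: adjoin_powers.
clearbody p; have -> : (t ^+ (e %% q)%N * r)^-1 * (t ^- a * t ^+ b * m) = r^-1 * m ^ p^-1 * p.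
  by rewrite -[RHS]mulgA -conjgCV pE invgM -!mulgA mulKg.
by apply: (subgroupM sK); [apply: sub_adjoin|].
Qed.

Hypothesis nf : no_free_semigroup G.

(** Adjoining the generators of L to N one by one gives a series in which every
    term contains the commutators of L, and so is normalized by L.  It is
    descended with [fg_of_adjoin], and P is then carried up. *)
Lemma abelian_chain L N : fg L -> subgroup N -> N `<=` L ->
  (forall x y, L x -> L y -> N [~ x, y]) ->
  fg N /\ forall P : set G -> Prop,
    (forall M t, fg M -> normalizes M t -> P M -> P (adjoin M t)) -> P N -> P L.
Proof.
move=> fL sN NL cLN; have [S LE] := fL.
have {LE} : L = generated (N `|` [set` S]).
  apply/seteqP; split; first by rewrite {1}LE; apply: genS; right.
  apply: gen_sub; first exact: fg_subgroup.
  by move=> x [/NL//|xS]; rewrite LE; apply: sub_gen.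
elim: S L fL NL cLN => [|s S IH] L fL NL cLN LE.
  have <- : L = N; last by split=> // P _.
  rewrite LE -[RHS](gen_id sN); congr generated; apply/seteqP.
  by split=> [x [//|]|x]; [rewrite /= in_nil|left].
have sL := fg_subgroup fL; pose L' := generated (N `|` [set` S]).
have NL' : N `<=` L' by move=> x Nx; apply: sub_gen; left.
have L'L : L' `<=` L.
  by rewrite LE; apply: genS => x [Nx|xS]; [left|right; rewrite /= inE xS orbT].
have Ls : L s by rewrite LE; apply: sub_gen; right; rewrite /= mem_head.
have sL' : subgroup L' by apply: subgroup_gen.
have nL' : normalizes L' s.
  have key u : L u -> forall x, L' x -> L' (x ^ u).
    move=> Lu x L'x; have -> : x ^ u = x * [~ x, u] by rewrite commgEl mulVKg.
    by apply: (subgroupM sL') => //; apply: NL'; apply: cLN => //; apply: L'L.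
  by apply: normalizesP; apply: key => //; apply: subgroupV.
have LA : L = adjoin L' s.
  apply/seteqP; split; last by apply: adjoin_sub.
  rewrite {1}LE; apply: gen_sub; first exact: subgroup_adjoin.
  move=> x [Nx|]; first by apply: sub_adjoin; apply: NL'.
  rewrite /= inE => /predU1P[->|xS]; first exact: adjoin_base.
  by apply: sub_adjoin; apply: sub_gen; right.
have fL' : fg L' by apply: fg_of_adjoin nL' _ => //; rewrite -LA.
have [|fN PN] := IH L' fL' NL' _ erefl; first by move=> x y /L'L Lx /L'L; apply: cLN.
split=> // P Padj PNn; rewrite LA.
exact: Padj fL' nL' (PN P Padj PNn).
Qed.

(** With M0 nilpotent of finite index in M and normalized by t ^+ k, the terms of
    its lower central series are finitely generated by [abelian_chain], so a
    power s of t ^+ k acts unipotently on M0. *)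
Lemma good_adjoin M t : fg M -> normalizes M t -> good M -> good (adjoin M t).
Proof.
move=> fM nM [[M0 [sM0 M0M fiM0 [c M0c]]] gM]; have sM := fg_subgroup fM.
have [k k0 nM0] := normalizing_power sM0 M0M fiM0 fM nM.
have fM0 : fg M0 := fg_finindex sM0 M0M fiM0 fM.
have fL j : fg (lower_central M0 j).
  elim: j => // j IH; have sL := fg_subgroup IH.
  have LM : lower_central M0 j.+1 `<=` lower_central M0 j.
    rewrite !lower_central_descending; apply: descending_sub => // y.
    exact: normalizes_sub.
  have LM0 : lower_central M0 j `<=` M0.
    rewrite lower_central_descending; elim: (j) => // i IHi.
    by apply: subset_trans IHi; apply: descending_sub => // y; apply: normalizes_sub.
  apply: (proj1 (abelian_chain IH _ LM _)); first exact: subgroup_gen.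
  by move=> x y Lx /LM0; rewrite !lower_central_descending in Lx *; apply: descendingR.
have [n n0 /(_ 1%N)] := descending_lower_central nf c sM0 nM0 fL.
rewrite muln1 M0c => -[i Di]; set s := (t ^+ k) ^+ n in Di.
have nM0s : normalizes M0 s by apply: normalizesX.
have sK1 := subgroup_adjoin sM0 nM0s.
have nMs : normalizes M s by do 2!apply: normalizesX.
have sK := subgroup_adjoin sM nM.
have K1K : adjoin M0 s `<=` adjoin M t.
  apply: adjoin_sub => //; first by apply: subset_trans M0M (@sub_adjoin _ M t).
  by do 2!apply: subgroupX => //; apply: adjoin_base.
apply: (good_finindex sK1 K1K) => //.
  have nM0q : normalizes M0 (t ^+ (k * n)) by rewrite expgnA.
  rewrite /s -expgnA; apply: (finindex_adjoin sM sM0 _ nM nM0q fiM0).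
  by rewrite muln_gt0 k0.
split; last first.
  exact: pgrowth_adjoin fM0 nM0s (pgrowthS M0M gM) Di.
exists (adjoin M0 s); split=> //; last exact: nilpotent_adjoin Di.
by exists [:: 1] => x Kx; exists 1; rewrite ?mem_head // invg1 mul1g.
Qed.

End CyclicStep.

(** * Elementary amenable groups *)

Section Sections.
Variable Gam : groupType.
Implicit Types (G H : groupType) (L N : set Gam) (x y : Gam).
Local Open Scope group_scope.
Hypothesis nf : no_free_semigroup Gam.

(** A subgroup of the product of Gam and G, as a relation.  Its kernel
    N := [set x | R x 1] is normal in its domain L, and L / N is a section of G:
    this encodes sections without quotient groups. *)
Definition subgroup_rel G (R : Gam -> G -> Prop) :=
  [/\ R 1 1, forall x g y h, R x g -> R y h -> R (x * y) (g * h)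
    & forall x g, R x g -> R x^-1 g^-1].

(** The kernel is only assumed to be good once it is finitely generated, because
    its finite generation is part of what has to be shown when G is finite or
    abelian, and because this makes the hypothesis transitive in extensions. *)
Definition tame G := forall L (R : Gam -> G -> Prop), fg L -> subgroup_rel R ->
  (forall x, L x <-> exists g, R x g) ->
  (fg [set x | R x 1] -> good [set x | R x 1]) -> good L.

Lemma subgroup_kernel G (R : Gam -> G -> Prop) : subgroup_rel R ->
  subgroup [set x | R x 1].
Proof.
case=> R1 RM RV; apply/subgroupP; split=> [//|x y Rx Ry|x Rx] /=.
  by have := RM _ _ _ _ Rx Ry; rewrite mulg1.
by have := RV _ _ Rx; rewrite invg1.
Qed.

Lemma subgroup_domain G (R : Gam -> G -> Prop) : subgroup_rel R ->
  subgroup [set x | exists g, R x g].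
Proof.
case=> R1 RM RV; apply/subgroupP; split=> [|x y [g xg] [h yh]|x [g xg]].
- by exists 1.
- by exists (g * h); apply: RM.
- by exists g^-1; apply: RV.
Qed.

(** The kernel has finite index in the domain. *)
Lemma tame_finite G : finite_set [set: G] -> tame G.
Proof.
move=> /finite_seqP[s sE] L R fL sR LR gN; have [R1 RM RV] := sR.
have sN := subgroup_kernel sR; have sL := fg_subgroup fL.
have NL : [set x | R x 1] `<=` L by move=> x Rx; apply/LR; exists 1.
have fiN : finindex [set x | R x 1] L.
  have [T TP] : exists T : seq Gam, forall x g, g \in s -> R x g ->
      exists2 r, r \in T & R (r^-1 * x) 1.
    elim: (s) => [|h s' [T TP]]; first by exists [::].
    have [[y yh]|nh] := pselect (exists y, R y h); last first.
      exists T => x g; rewrite inE => /predU1P[-> xh|]; last exact: TP.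
      by case: nh; exists x.
    exists (y :: T) => x g; rewrite inE => /predU1P[-> xh|gs xg].
      by exists y; rewrite ?mem_head // -(mulVg h); apply: RM => //; apply: RV.
    by have [r rT Rr] := TP x g gs xg; exists r => //; rewrite inE rT orbT.
  exists T => x /LR[g xg]; apply: TP xg.
  by have : [set: G] g by []; rewrite sE.
by apply: (good_finindex sN NL fiN sL); apply: gN; apply: fg_finindex fiN fL.
Qed.

Lemma tame_abelian G : (forall g h : G, commute g h) -> tame G.
Proof.
move=> cG L R fL sR LR gN; have [R1 RM RV] := sR.
have NL : [set x | R x 1] `<=` L by move=> x Rx; apply/LR; exists 1.
have [|fN PN] := abelian_chain nf fL (subgroup_kernel sR) NL.
  move=> x y /LR[g xg] /LR[h yh] /=.
  have -> : 1 = [~ g, h] by apply/esym/eqP/commgP/cG.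
  rewrite !commgEl !conjgE; apply: (RM) => //; first exact: RV.
  by apply: (RM); [apply: RV|apply: (RM)].
by apply: PN (gN fN) => M t; apply: good_adjoin.
Qed.

Lemma tame_subgroup G H (f : H -> G) :
  monoid.monoid_morphism f -> injective f -> tame G -> tame H.
Proof.
move=> [f1 fM] fI tG L R fL [R1 RM RV] LR gN.
have fV h : f h^-1 = (f h)^-1 by apply/esym/mulg1_eq; rewrite -fM mulgV.
pose R' x g := exists2 h, R x h & g = f h.
have KE : [set x | R' x 1] = [set x | R x 1].
  apply/seteqP; split=> x /=; last by exists 1.
  by case=> h xh; rewrite -f1 => /fI ->.
apply: (tG L R' fL); rewrite ?KE //.
  split; first by exists 1.
    by move=> x _ y _ [g xg ->] [h yh ->]; exists (g * h); [apply: RM|rewrite fM].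
  by move=> x _ [g xg ->]; exists g^-1; [apply: RV|rewrite fV].
by move=> x; split=> [/LR[h xh]|[_ [h xh _]]]; [exists (f h), h|apply/LR; exists h].
Qed.

Lemma tame_quotient G H (f : G -> H) :
  monoid.monoid_morphism f -> range f = [set: H] -> tame G -> tame H.
Proof.
move=> [f1 fM] f_surj tG L R fL [R1 RM RV] LR gN.
have fV h : f h^-1 = (f h)^-1 by apply/esym/mulg1_eq; rewrite -fM mulgV.
apply: (tG L (fun x g => R x (f g)) fL); rewrite ?f1 //.
  split; first by rewrite f1.
    by move=> x g y h; rewrite fM; apply: RM.
  by move=> x g; rewrite fV; apply: RV.
move=> x; split=> [/LR[h xh]|[g xg]]; last by apply/LR; exists (f g).
have [g _ gh] : range f h by rewrite f_surj.
by exists g; rewrite gh.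
Qed.

(** The elements of L related to the image of K form the kernel over H, and the
    domain of a relation with K that has the same kernel as R. *)
Lemma tame_extension (K : groupType) G H (f : K -> G) (q : G -> H) :
  monoid.monoid_morphism f -> monoid.monoid_morphism q -> injective f ->
  range f = q @^-1` [set 1] -> tame K -> tame H -> tame G.
Proof.
move=> [f1 fM] [q1 qM] fI fq tK tH L R fL sR LR gN; have [R1 RM RV] := sR.
have fV h : f h^-1 = (f h)^-1 by apply/esym/mulg1_eq; rewrite -fM mulgV.
have qV h : q h^-1 = (q h)^-1 by apply/esym/mulg1_eq; rewrite -qM mulgV.
pose RH x h := exists2 g, R x g & h = q g.
pose RK x k := R x (f k).
apply: (tH L RH fL).
- split; first by exists 1.
    by move=> x _ y _ [g xg ->] [h yh ->]; exists (g * h); [apply: RM|rewrite qM].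
  by move=> x _ [g xg ->]; exists g^-1; [apply: RV|rewrite qV].
- by move=> x; split=> [/LR[h xh]|[_ [h xh _]]]; [exists (q h), h|apply/LR; exists h].
move=> fN; apply: (tK _ RK fN); rewrite /RK ?f1 //.
  split; first by rewrite f1.
    by move=> x g y h; rewrite fM; apply: RM.
  by move=> x g; rewrite fV; apply: RV.
move=> x /=; split=> [[g xg qg]|[k xk]].
  by have [k _ kg] : range f g by [rewrite fq]; exists k; rewrite kg.
exists (f k) => //; have : range f (f k) by exists k.
by rewrite fq.
Qed.

(** The generators of L are related to elements of a common term of the union. *)
Lemma tame_union G (I : Type) (H : I -> groupType) (f : forall i, H i -> G) :
  (forall i, monoid.monoid_morphism (f i)) -> (forall i, injective (f i)) ->
  (forall i j, exists k, range (f i) `|` range (f j) `<=` range (f k)) ->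
  \bigcup_i range (f i) = [set: G] -> (forall i, tame (H i)) -> tame G.
Proof.
move=> fmor fI fdir fU tH L R fL sR LR gN; have [R1 RM RV] := sR.
have [S LE] := fL; have i0 : exists i : I, True.
  have [i _ _] : (\bigcup_i range (f i)) 1 by rewrite fU.
  by exists i.
have [i SP] : exists i, forall x, x \in S -> exists h, R x (f i h).
  have: [set` S] `<=` L by rewrite LE; apply: sub_gen.
  elim: (S) => [|x T IH] TL; first by case: i0 => i _; exists i.
  have [|i iT] := IH; first by move=> y yT; apply: TL; rewrite /= inE yT orbT.
  have /LR[g xg] : L x by apply: TL; rewrite /= mem_head.
  have [j _ [h _ hg]] : (\bigcup_i range (f i)) g by rewrite fU.
  have [k ijk] := fdir i j; exists k => y; rewrite inE => /predU1P[->|/iT[h' yh']].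
    have [h'' _ e] : range (f k) (f j h) by apply: ijk; right; exists h.
    by exists h''; rewrite e hg.
  have [h'' _ e] : range (f k) (f i h') by apply: ijk; left; exists h'.
  by exists h''; rewrite e.
have [f1 fM] := fmor i.
have fV h : f i h^-1 = (f i h)^-1 by apply/esym/mulg1_eq; rewrite -fM mulgV.
have sR' : subgroup_rel (fun x h => R x (f i h)).
  split; first by rewrite f1.
    by move=> x g y h; rewrite fM; apply: RM.
  by move=> x g; rewrite fV; apply: RV.
apply: (tH i L (fun x h => R x (f i h)) fL sR'); rewrite ?f1 // => x.
split=> [|[h xh]]; last by apply/LR; exists (f i h).
rewrite LE; move: x; apply: gen_sub; first exact: subgroup_domain sR'.
exact: SP.
Qed.

Lemma elementary_amenable_tame G : elementary_amenable G -> tame G.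
Proof.
elim=> {G}.
- exact: tame_finite.
- exact: tame_abelian.
- move=> G H f fmor fI _; exact: tame_subgroup fmor fI.
- move=> G H f fmor f_surj _; exact: tame_quotient fmor f_surj.
- move=> K G H f q fmor qmor fI fq _ _ tK _ tH.
  exact: tame_extension fmor qmor fI fq tK tH.
- move=> G I H f fmor fI fdir fU _ tH; exact: tame_union fmor fI fdir fU tH.
Qed.

Lemma elementary_amenable_good :
  fg [set: Gam] -> elementary_amenable Gam -> good [set: Gam].
Proof.
move=> fT /elementary_amenable_tame tGam.
have sT : subgroup [set: Gam] by apply/subgroupP.
apply: (tGam _ (fun x y => x = y) fT).
- by split=> // [x _ y _ <- <-|x _ <-].
- by move=> x; split=> // _; exists x.
- move=> _; have s1 := @subgroup_trivial Gam; split; last first.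
    move=> T T1; exists 1%N, 0%N => n; exists [:: 1] => // x /(ball_sub s1 T1) ->.
    by rewrite /= mem_head.
  exists [set 1]; split=> //; last by exists 0%N.
  by exists [:: 1] => x /= ->; exists 1; rewrite ?mem_head ?mulVg.
Qed.

End Sections.

Section Conclusion.
Local Open Scope card_scope.
Variable G : groupType.
Local Open Scope group_scope.

Lemma virtually_nilpotent_of_good : good [set: G] -> virtually_nilpotent G.
Proof.
case=> -[H [sH _ [R RP] nH]] _; exists H; split=> //.
apply: (@sub_finite_set _ _ ((fun x : G => [set x * h | h in H]) @` [set` R])).
  move=> _ [x _ <-]; have [r rR Hr] := RP x I; exists r => //.
  apply/seteqP; split=> _ [h Hh <-].
    exists (x^-1 * (r * h)); last by rewrite mulVKg.
    rewrite mulgA; apply: subgroupM => //; rewrite -[x]invgK -[r]invgK.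
    by rewrite -invgM invgK; apply: subgroupV.
  by exists (r^-1 * x * h); [apply: subgroupM|rewrite -!mulgA mulVKg].
exact: finite_image (finite_seq R).
Qed.

(** A path of length m spells a word of length m. *)
Lemma dist_ball (S : seq G) (genS : generates S) (v : G) n :
  (dist ((1 : G)%g : cayley_graph genS) (v : cayley_graph genS) <= n)%N -> ball [set` S] n v.
Proof.
rewrite /dist; case: ex_minnP => m /asboolP[p [p1 pv pm]] _ mn.
apply: (ball_le mn); rewrite -{m mn}pm.
elim/last_ind: p v p1 pv => [v _ <- //|p w IH v].
rewrite rcons_path last_rcons size_rcons => /andP[p1 pw] <-.
rewrite -addn1 -(mulVKg (last 1 p) w); apply: ball_mul; first exact: IH.
apply: ball_letter; move: pw => /andP[_ /orP[|]] h; [constructor 2 => //|constructor 3].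
by rewrite invgM invgK.
Qed.

Lemma polynomial_growth_of_good (S : seq G) : generates S -> good [set: G] ->
  polynomial_growth G.
Proof.
move=> genS [_ gG]; have [C [d CP]] := gG S (@subsetT _ _).
exists S, genS, d, (C * 2 ^ d).+1 => // n n0; have [l sl bl] := CP n.
have sub : [set v | (dist ((1 : G)%g : cayley_graph genS) v <= n)%N] `<=` [set` l].
  by move=> v /dist_ball; apply: bl.
apply: card_le_trans (subset_card_le sub) _.
have /finite_setP[m lm] := finite_seq l.
rewrite (card_le_eql lm) card_le_II.
have <- : size (enum_fset (fset_set [set` l])) = m by apply: card_fset_set lm.
apply: (@leq_trans (size l)).
  apply: uniq_leq_size; first exact: fset_uniq.
  move=> x; rewrite in_fset_set ?inE //; exact: finite_seq.
apply: leq_trans sl _; apply: (@leq_trans (C * 2 ^ d * n ^ d)%N).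
  rewrite -mulnA -expnMn leq_mul2l; apply/orP; right.
  by case: (d) => // e; rewrite leq_exp2r //; lia.
by rewrite leq_mul2r leqnSn orbT.
Qed.

End Conclusion.

Theorem corollary10 (Gamma : groupType) :
  finitely_generated Gamma ->
  elementary_amenable Gamma ->
  polynomial_containment Gamma ->
  virtually_nilpotent Gamma /\ polynomial_growth Gamma.
Proof.
move=> [S0 genS0] eaG [d [S [genS contS]]].
have nf := containment_no_free_semigroup contS.
have fT : fg [set: Gamma] by exists S.
have gT := elementary_amenable_good nf fT eaG.
by split; [apply: virtually_nilpotent_of_good|apply: polynomial_growth_of_good genS gT].
Qed.
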